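(* The only singularities of the solutions of the Painlevé P1 equation $$\frac{d^2y}{dx^2}=6y^2+x$$ are second order poles. That is, every solution $y$ that is analytic at some point $a\in\mathbb{C}$ extends to a meromorphic function on $\mathbb{C}$, all of whose poles are of order two.
   Context: Here $x$ is a complex variable and $y$ is a complex-valued solution, holomorphic near some point $a\in\mathbb{C}$; singularities refer to points of the finite complex plane $\mathbb{C}$. *)

(* Defs.v *)
(* Stdlib reals + Coquelicot. *)
From Stdlib Require Export Reals.
From Coquelicot Require Export Coquelicot.
Open Scope C_scope.

(* Coquelicot has several convertible structures on C; all topology below is
   taken in C_UniformSpace and all derivatives are complex ones (scalars in
   C_AbsRing). *)

Definition C_open (U : C -> Prop) : Prop := open (T := C_UniformSpace) U.

Definition C_connected (U : C -> Prop) : Prop :=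
  forall A B : C -> Prop,
    C_open A -> C_open B ->
    (forall z, U z -> A z \/ B z) ->
    (exists z, U z /\ A z) -> (exists z, U z /\ B z) ->
    exists z, U z /\ A z /\ B z.

Definition is_domain (U : C -> Prop) : Prop :=
  C_open U /\ C_connected U /\ exists z, U z.

Definition C_differentiable (f : C -> C) (z : C) : Prop :=
  ex_derive (K := C_AbsRing) (V := C_NormedModule) f z.

Definition holomorphic_at (f : C -> C) (p : C) : Prop :=
  locally (T := C_UniformSpace) p (C_differentiable f).

(* Functions are total, so the value f p at a pole p is irrelevant. *)
Definition pole_of_order (f : C -> C) (n : nat) (p : C) : Prop :=
  (1 <= n)%nat /\
  exists g : C -> C,
    holomorphic_at g p /\ g p <> 0 /\
    locally' (T := C_UniformSpace) p (fun z => f z = g z / (z - p) ^ n).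

(* That the poles are isolated follows: f is holomorphic on a punctured
   neighbourhood of each of them. *)
Definition meromorphic (f : C -> C) : Prop :=
  forall p, holomorphic_at f p \/ exists n, pole_of_order f n p.

(* On an open U, C_derive y is the derivative of y near every point of U, so
   the second clause says that y'' exists and equals 6 y^2 + x on U. *)
Definition P1_solution_on (U : C -> Prop) (y : C -> C) : Prop :=
  forall x, U x ->
    C_differentiable y x /\
    is_derive (K := C_AbsRing) (V := C_NormedModule)
      (C_derive y) x (6 * y x ^ 2 + x).

(* Main.v *)
Require Import Defs.
From Stdlib Require Import Lra Lia Psatz Classical ClassicalEpsilon.

(* Near a pole the substitution y = u^-2, y' = -2 u^-3 - x u / 2 - u^2 / 2 + u^3 v turns P1
   into a polynomial system for (u, v) with u' = 1 where u = 0, so a solution with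
   bounded (u, v) continues meromorphically, with double poles only.  To see that a
   solution is always bounded in one of the two charts (y, y'), (u, v), consider
     V = y'^2 - 4 y^3 - 2 x y + y' conj(y) / (1 + |y|^2).
   Along a segment |dV/dt| <= C (1 + |V|), and V extends to the poles by -4 v, so V is
   bounded on bounded sets by Gronwall's inequality.  A bound on V and x bounds y' where
   |y| <= 1 and (u, v) where |y| >= 1.  Hence the solution continues from each of its
   regular points to a disc of a radius that is uniform on bounded sets, and it extends
   to the whole plane. *)

(** * Complex derivatives *)

(** Without its last term the energy V0 = y'^2 - 4 y^3 - 2 x y has derivative -2 y along solutions,
    and would itself have a simple pole at every pole of y. Adding y'/y repairs this, since (y'/y)'
    = 2 y - x/y - V0/y^2. But y'/y is singular at the zeros of y, whence the replacement of 1/y by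
    conj(y) / (1 + |y|^2). The price is that V is not holomorphic, so it is differentiated along
    real segments only. The gain is that V stays bounded and differentiable on a segment that runs
    through poles, so no path has to be bent around them. The substitution comes from the Laurent
    expansion y = t^-2 - (p/10) t^2 - t^3/6 + h t^4 + ..., t = x - p, in which h is arbitrary. With
    u = y^(-1/2), the sum y' + 2 u^-3 starts with -(x u + u^2)/2, and h first enters it through 7 h
    t^3. Hence v, with v(p) = 7 h, takes the place of h as the free parameter of the solutions with
    a pole at p. *)

Definition disc (p : C) (r : R) (z : C) : Prop := Cmod (z - p) < r.

Lemma locally_disc (p : C) (P : C -> Prop) :
  locally (T := C_UniformSpace) p P <->
  exists d : R, 0 < d /\ forall z, disc p d z -> P z.
Proof.
  split.
  - intros [e He]. exists e. split; [apply cond_pos|].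
    intros z Hz. apply He, C_NormedModule_mixin_compat1, Hz.
  - intros [d [Hd H]].
    assert (Hs : 0 < sqrt 2) by (apply sqrt_lt_R0; lra).
    assert (He : 0 < d / sqrt 2) by (apply Rdiv_lt_0_compat; lra).
    exists (mkposreal _ He). intros z Hz. apply H.
    apply C_NormedModule_mixin_compat2 in Hz. simpl in Hz. unfold disc.
    replace d with (sqrt 2 * (d / sqrt 2))%R by (field; lra). exact Hz.
Qed.

(** The linear approximation with explicit [eps] and [del], since the estimates below work on the
    inequality itself; [cder_is_derive] links it to the derivative used in the statement. *)
Definition cder (f : C -> C) (z l : C) : Prop :=
  forall eps : R, 0 < eps -> exists del : R, 0 < del /\
    forall w, disc z del w ->
      Cmod (f w - f z - l * (w - z)) <= eps * Cmod (w - z).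

Lemma cder_is_derive (f : C -> C) (z l : C) :
  cder f z l <-> is_derive (K := C_AbsRing) (V := C_NormedModule) f z l.
Proof.
  split.
  - intros H. split; [apply is_linear_scal_l|].
    intros x Hx eps.
    apply (@is_filter_lim_locally_unique C_AbsRing (AbsRing_NormedModule C_AbsRing)) in Hx. subst x.
    destruct (H eps (cond_pos eps)) as [d [Hd Hb]].
    exists (mkposreal d Hd). intros w Hw.
    specialize (Hb w Hw).
    change (Cmod (f w - f z - (w - z) * l) <= eps * Cmod (w - z)).
    now rewrite (Cmult_comm (w - z)).
  - intros [_ H] eps Heps.
    destruct (H z (fun P HP => HP) (mkposreal eps Heps)) as [d Hb].
    exists d. split; [apply cond_pos|]. intros w Hw. specialize (Hb w Hw).
    change (Cmod (f w - f z - (w - z) * l) <= eps * Cmod (w - z)) in Hb.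
    now rewrite (Cmult_comm (w - z)) in Hb.
Qed.

Lemma disc_center (p : C) (r : R) : 0 < r -> disc p r p.
Proof. intros H. unfold disc. replace (p - p) with (RtoC 0) by ring. now rewrite Cmod_0. Qed.

Lemma disc_open (p : C) (r : R) (z : C) : disc p r z ->
  exists d : R, 0 < d /\ forall w, disc z d w -> disc p r w.
Proof.
  intros H. exists (r - Cmod (z - p))%R. split; [unfold disc in H; lra|].
  intros w Hw. unfold disc in *.
  replace (w - p) with ((w - z) + (z - p)) by ring.
  eapply Rle_lt_trans; [apply Cmod_triangle|]. lra.
Qed.

Lemma Cmod_minus_sym (a b : C) : Cmod (a - b) = Cmod (b - a).
Proof. rewrite <- Cmod_opp. f_equal. ring. Qed.

Lemma Cmod_triangle_minus (a b : C) : Cmod (a - b) <= Cmod a + Cmod b.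
Proof. rewrite <- (Cmod_opp b). apply Cmod_triangle. Qed.

Lemma Cmod_triangle_inv (a b : C) : Cmod a - Cmod b <= Cmod (a - b).
Proof. pose proof (Cmod_triangle (a - b) b). replace (a - b + b) with a in H by ring. lra. Qed.

Lemma cder_lip (f : C -> C) (z l : C) : cder f z l ->
  exists d : R, 0 < d /\ forall w, disc z d w -> Cmod (f w - f z) <= (Cmod l + 1) * Cmod (w - z).
Proof.
  intros H. destruct (H 1%R Rlt_0_1) as [d [Hd Hb]].
  exists d. split; [exact Hd|]. intros w Hw. specialize (Hb w Hw).
  replace (f w - f z) with ((f w - f z - l * (w - z)) + l * (w - z)) by ring.
  eapply Rle_trans; [apply Cmod_triangle|]. rewrite (Cmod_mult l). lra.
Qed.

Definition ccont (f : C -> C) (z : C) : Prop :=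
  forall eps : R, 0 < eps -> exists del : R, 0 < del /\
    forall w, disc z del w -> Cmod (f w - f z) < eps.

Lemma cder_ccont (f : C -> C) (z l : C) : cder f z l -> ccont f z.
Proof.
  intros H eps He. destruct (cder_lip f z l H) as [d [Hd Hb]].
  pose proof (Cmod_ge_0 l).
  assert (H1 : 0 < eps / (Cmod l + 1)) by (apply Rdiv_lt_0_compat; lra).
  exists (Rmin d (eps / (Cmod l + 1))). split; [now apply Rmin_pos|].
  intros w Hw. unfold disc in Hw.
  pose proof (Rmin_l d (eps / (Cmod l + 1))). pose proof (Rmin_r d (eps / (Cmod l + 1))).
  eapply Rle_lt_trans; [apply Hb; unfold disc; lra|].
  apply Rlt_le_trans with ((Cmod l + 1) * (eps / (Cmod l + 1)))%R.
  - apply Rmult_lt_compat_l; lra.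
  - right. field. lra.
Qed.

Lemma cder_ext_loc (f g : C -> C) (z l : C) (d : R) : 0 < d ->
  (forall w, disc z d w -> f w = g w) -> cder f z l -> cder g z l.
Proof.
  intros Hd He H eps Heps. destruct (H eps Heps) as [d' [Hd' Hb]].
  exists (Rmin d d'). split; [now apply Rmin_pos|].
  intros w Hw. unfold disc in Hw.
  pose proof (Rmin_l d d'). pose proof (Rmin_r d d').
  rewrite <- !He by (unfold disc; try lra; apply disc_center; lra).
  apply Hb. unfold disc; lra.
Qed.

Lemma cder_val (f : C -> C) (z l m : C) : l = m -> cder f z l -> cder f z m.
Proof. now intros ->. Qed.

Lemma cder_const (c z : C) : cder (fun _ => c) z 0.
Proof.
  intros eps He. exists 1%R. split; [lra|]. intros w _.
  replace (c - c - 0 * (w - z)) with (RtoC 0) by ring. rewrite Cmod_0.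
  apply Rmult_le_pos; [lra|apply Cmod_ge_0].
Qed.

Lemma cder_id (z : C) : cder (fun w => w) z 1.
Proof.
  intros eps He. exists 1%R. split; [lra|]. intros w _.
  replace (w - z - 1 * (w - z)) with (RtoC 0) by ring. rewrite Cmod_0.
  apply Rmult_le_pos; [lra|apply Cmod_ge_0].
Qed.

Lemma cder_plus (f g : C -> C) (z l m : C) :
  cder f z l -> cder g z m -> cder (fun w => f w + g w) z (l + m).
Proof.
  rewrite !cder_is_derive.
  exact (is_derive_plus (K := C_AbsRing) (V := C_NormedModule) f g z l m).
Qed.

(** The product rule speaks of C as a module over itself, [cder_is_derive] of [C_NormedModule]. The
    estimate is the same for both up to conversion; just the linearity component is rebuilt. *)
Lemma is_derive_C_codomain (f : C -> C) (z l : C) :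
  is_derive (K := C_AbsRing) (V := C_NormedModule) f z l <->
  is_derive (K := C_AbsRing) (V := AbsRing_NormedModule C_AbsRing) f z l.
Proof. split; intros [_ H]; (split; [apply is_linear_scal_l|exact H]). Qed.

Lemma cder_mult (f g : C -> C) (z l m : C) :
  cder f z l -> cder g z m -> cder (fun w => f w * g w) z (l * g z + f z * m).
Proof.
  rewrite !cder_is_derive, !is_derive_C_codomain. intros H1 H2.
  exact (is_derive_mult (K := C_AbsRing) f g z l m H1 H2 Cmult_comm).
Qed.

Lemma cder_scal (c z : C) : cder (fun w => c * w) z c.
Proof.
  apply cder_val with (0 * z + c * 1); [ring|].
  exact (cder_mult (fun _ => c) (fun w => w) z 0 1 (cder_const c z) (cder_id z)).
Qed.

Lemma cder_opp (f : C -> C) (z l : C) : cder f z l -> cder (fun w => - f w) z (- l).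
Proof.
  rewrite !cder_is_derive.
  exact (is_derive_opp (K := C_AbsRing) (V := C_NormedModule) f z l).
Qed.

Lemma cder_minus (f g : C -> C) (z l m : C) :
  cder f z l -> cder g z m -> cder (fun w => f w - g w) z (l - m).
Proof. intros H1 H2. exact (cder_plus _ _ _ _ _ H1 (cder_opp _ _ _ H2)). Qed.

Lemma cder_pow (f : C -> C) (z l : C) (n : nat) :
  cder f z l -> cder (fun w => f w ^ n) z (INR n * f z ^ pred n * l).
Proof.
  intros H. induction n as [|n IH].
  - apply (cder_val _ _ 0); [simpl; ring|]. exact (cder_const 1 z).
  - simpl Cpow. eapply cder_val; [|exact (cder_mult _ _ _ _ _ H IH)].
    rewrite S_INR, RtoC_plus. destruct n; simpl; ring.
Qed.

Lemma cder_inv (f : C -> C) (z l : C) : f z <> 0 ->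
  cder f z l -> cder (fun w => / f w) z (- l / f z ^ 2).
Proof.
  intros Hz H eps He.
  assert (Hm : 0 < Cmod (f z)) by now apply Cmod_gt_0.
  set (m := Cmod (f z)) in *.
  destruct (cder_ccont _ _ _ H (m / 2)%R ltac:(lra)) as [d1 [Hd1 Hc]].
  destruct (cder_lip _ _ _ H) as [d2 [Hd2 HL]].
  assert (He1 : 0 < eps * m ^ 2 / 4) by (apply Rdiv_lt_0_compat; [apply Rmult_lt_0_compat; [lra|apply pow_lt; lra]|lra]).
  destruct (H _ He1) as [d3 [Hd3 Hb]].
  set (L := (Cmod l + 1)%R). assert (HL0 : 0 < L) by (unfold L; pose proof (Cmod_ge_0 l); lra).
  set (d4 := (eps * m ^ 3 / (4 * L ^ 2))%R).
  assert (Hd4 : 0 < d4).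
  { apply Rdiv_lt_0_compat; repeat apply Rmult_lt_0_compat; try lra. }
  exists (Rmin (Rmin d1 d2) (Rmin d3 d4)). split; [repeat apply Rmin_pos; lra|].
  intros w Hw. unfold disc in Hw.
  pose proof (Rmin_l (Rmin d1 d2) (Rmin d3 d4)). pose proof (Rmin_r (Rmin d1 d2) (Rmin d3 d4)).
  pose proof (Rmin_l d1 d2). pose proof (Rmin_r d1 d2).
  pose proof (Rmin_l d3 d4). pose proof (Rmin_r d3 d4).
  specialize (Hc w ltac:(unfold disc; lra)). specialize (HL w ltac:(unfold disc; lra)).
  specialize (Hb w ltac:(unfold disc; lra)). fold L in HL.
  assert (Hfw : m / 2 < Cmod (f w)).
  { pose proof (Cmod_triangle_inv (f z) (f w)). rewrite Cmod_minus_sym in H6. fold m in H6. lra. }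
  assert (Hw0 : f w <> 0) by (apply Cmod_gt_0; lra).
  set (D := f w - f z) in *. set (E := D - l * (w - z)) in *.
  (* The exact remainder: [D * D] is quadratic in w - z and [E] is the remainder of [f]. The
     thresholds [d4] and [d3] make their contributions at most eps/2 and eps/4 times |w - z|. *)
  replace (/ f w - / f z - - l / f z ^ 2 * (w - z)) with ((D * D - f w * E) / (f w * f z ^ 2)).
  2:{ unfold E, D. field. auto. }
  rewrite Cmod_div by (apply Cmult_neq_0; [auto|apply Cpow_nz; auto]).
  rewrite Cmod_mult, Cmod_pow. fold m.
  set (h := Cmod (w - z)) in *. assert (0 <= h) by apply Cmod_ge_0.
  assert (HF : 0 < Cmod (f w)) by lra. set (F := Cmod (f w)) in *.
  apply Rle_trans with ((Cmod D * Cmod D + F * Cmod E) / (F * m ^ 2))%R.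
  { apply Rmult_le_compat_r. left. apply Rinv_0_lt_compat. apply Rmult_lt_0_compat; [lra|apply pow_lt; lra].
    eapply Rle_trans; [apply Cmod_triangle_minus|]. rewrite !Cmod_mult. apply Rle_refl. }
  assert (HDD : Cmod D * Cmod D <= eps * m ^ 3 / 4 * h).
  { apply Rle_trans with ((L * h) * (L * h))%R.
    - apply Rmult_le_compat; auto using Cmod_ge_0.
    - replace ((L * h) * (L * h))%R with ((L ^ 2 * h) * h)%R by ring.
      apply Rmult_le_compat_r; [lra|].
      apply Rle_trans with (L ^ 2 * d4)%R.
      apply Rmult_le_compat_l; [apply pow_le; lra|lra].
      right. unfold d4. field. lra. }
  apply Rle_trans with ((eps * m ^ 3 / 4 * h + F * (eps * m ^ 2 / 4 * h)) / (F * m ^ 2))%R.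
  { apply Rmult_le_compat_r. left. apply Rinv_0_lt_compat. apply Rmult_lt_0_compat; [lra|apply pow_lt; lra].
    apply Rplus_le_compat; [exact HDD|]. apply Rmult_le_compat_l; lra. }
  replace ((eps * m ^ 3 / 4 * h + F * (eps * m ^ 2 / 4 * h)) / (F * m ^ 2))%R
    with ((eps * h / 4) * (m / F + 1))%R by (field; split; lra).
  assert (m / F <= 2).
  { apply Rmult_le_reg_r with F; [lra|]. unfold Rdiv. rewrite Rmult_assoc, Rinv_l by lra. lra. }
  assert (0 <= eps * h) by (apply Rmult_le_pos; lra).
  nra.
Qed.

(** * Derivatives along a real parameter *)

(** Componentwise, because the energy involves conjugation and is differentiated in the real sense
    only, and because the components are open to the real mean value theorem. *)
Definition rder (g : R -> C) (t : R) (l : C) : Prop :=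
  is_derive (fun s => Re (g s)) t (Re l) /\ is_derive (fun s => Im (g s)) t (Im l).

Lemma is_derive_eps (f : R -> R) (t l : R) :
  (forall eps, 0 < eps -> exists del, 0 < del /\
    forall s, Rabs (s - t) < del -> Rabs (f s - f t - l * (s - t)) <= eps * Rabs (s - t)) ->
  is_derive f t l.
Proof.
  intros H. split; [apply is_linear_scal_l|].
  intros x Hx eps.
  apply (@is_filter_lim_locally_unique R_AbsRing (AbsRing_NormedModule R_AbsRing)) in Hx. subst x.
  destruct (H eps (cond_pos eps)) as [d [Hd Hb]].
  exists (mkposreal d Hd). intros w Hw. specialize (Hb w Hw).
  change (Rabs (f w - f t - (w - t) * l) <= eps * Rabs (w - t)).
  now rewrite (Rmult_comm (w - t)).
Qed.

Lemma im_le_Cmod (c : C) : Rabs (Im c) <= Cmod c.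
Proof. eapply Rle_trans; [|apply Rmax_Cmod]. apply Rmax_r. Qed.

Lemma rder_eps (g : R -> C) (t : R) (l : C) :
  (forall eps, 0 < eps -> exists del, 0 < del /\
    forall s, Rabs (s - t) < del -> Cmod (g s - g t - l * (s - t)%R) <= eps * Rabs (s - t)) ->
  rder g t l.
Proof.
  intros H. split; apply is_derive_eps; intros eps He;
    destruct (H eps He) as [d [Hd Hb]]; exists d; (split; [exact Hd|]); intros s Hs;
    specialize (Hb s Hs).
  - replace (Re (g s) - Re (g t) - Re l * (s - t))%R with (Re (g s - g t - l * (s - t)%R)).
    + eapply Rle_trans; [apply re_le_Cmod|exact Hb].
    + unfold Re, Im. simpl. ring.
  - replace (Im (g s) - Im (g t) - Im l * (s - t))%R with (Im (g s - g t - l * (s - t)%R)).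
    + eapply Rle_trans; [apply im_le_Cmod|exact Hb].
    + unfold Re, Im. simpl. ring.
Qed.

Lemma cder_rder (f : C -> C) (p e : C) (t : R) (l : C) :
  cder f (p + t * e) l -> rder (fun s : R => f (p + s * e)) t (l * e).
Proof.
  intros H. apply rder_eps. intros eps He. pose proof (Cmod_ge_0 e).
  assert (H1 : 0 < eps / (Cmod e + 1)) by (apply Rdiv_lt_0_compat; lra).
  destruct (H _ H1) as [d [Hd Hb]].
  exists (d / (Cmod e + 1))%R. split; [apply Rdiv_lt_0_compat; lra|].
  intros s Hs.
  assert (Hse : Cmod ((p + s * e) - (p + t * e)) = (Rabs (s - t) * Cmod e)%R).
  { replace ((p + s * e) - (p + t * e)) with (RtoC (s - t) * e) by (rewrite RtoC_minus; ring).
    now rewrite Cmod_mult, Cmod_R. }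
  assert (Hd2 : Rabs (s - t) * (Cmod e + 1) < d).
  { apply Rlt_le_trans with (d / (Cmod e + 1) * (Cmod e + 1))%R.
    apply Rmult_lt_compat_r; lra. right; field; lra. }
  pose proof (Rabs_pos (s - t)).
  specialize (Hb (p + s * e)). unfold disc in Hb. rewrite Hse in Hb.
  specialize (Hb ltac:(nra)).
  replace (l * e * (s - t)%R) with (l * (p + s * e - (p + t * e))) by (rewrite RtoC_minus; ring).
  eapply Rle_trans; [exact Hb|].
  replace (eps / (Cmod e + 1) * (Rabs (s - t) * Cmod e))%R
    with (eps * Rabs (s - t) * (Cmod e / (Cmod e + 1)))%R by (field; lra).
  rewrite <- (Rmult_1_r (eps * Rabs (s - t))) at 2.
  apply Rmult_le_compat_l; [nra|].
  apply Rmult_le_reg_r with (Cmod e + 1)%R; [lra|].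
  unfold Rdiv. rewrite Rmult_assoc, Rinv_l; lra.
Qed.

Lemma Re_conj_mul_le (a b : C) : Re a * Re b + Im a * Im b <= Cmod a * Cmod b.
Proof.
  rewrite <- (Cmod_conj a), <- Cmod_mult.
  replace (Re a * Re b + Im a * Im b)%R with (Re (Cconj a * b)) by (unfold Re, Im; simpl; ring).
  eapply Rle_trans; [apply Rle_abs|apply re_le_Cmod].
Qed.

(** The real mean value theorem is applied to the projection of [g] onto the increment [c]; this
    yields |c|^2 <= |c| M. *)
Lemma rder_mvt (g l : R -> C) (M : R) :
  (forall t, 0 <= t <= 1 -> rder g t (l t)) -> (forall t, 0 <= t <= 1 -> Cmod (l t) <= M) ->
  Cmod (g 1%R - g 0%R) <= M.
Proof.
  intros Hd HM. set (c := g 1%R - g 0%R).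
  assert (Hder : forall t, 0 <= t <= 1 ->
    is_derive (fun s => Re c * Re (g s) + Im c * Im (g s))%R t (Re c * Re (l t) + Im c * Im (l t))%R).
  { intros t Ht. destruct (Hd t Ht) as [H1 H2].
    apply (is_derive_plus (V := R_NormedModule)).
    - now apply is_derive_scal.
    - now apply is_derive_scal. }
  destruct (MVT_gen (fun s => Re c * Re (g s) + Im c * Im (g s))%R 0 1
    (fun t => Re c * Re (l t) + Im c * Im (l t))%R) as [t [Ht Heq]].
  - intros t Ht. rewrite Rmin_left, Rmax_right in Ht by lra. apply Hder; lra.
  - intros t Ht. rewrite Rmin_left, Rmax_right in Ht by lra.
    apply derivable_continuous_pt. eexists. apply is_derive_Reals, Hder; lra.
  - rewrite Rmin_left, Rmax_right in Ht by lra.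
    assert (Hc : (Cmod c ^ 2)%R = (Re c * Re (l t) + Im c * Im (l t))%R).
    { rewrite Cmod2_alt. replace (Re c * Re (l t) + Im c * Im (l t))%R
        with ((Re c * Re (l t) + Im c * Im (l t)) * (1 - 0))%R by ring.
      rewrite <- Heq. unfold c, Re, Im. simpl. ring. }
    pose proof (Re_conj_mul_le c (l t)). pose proof (HM t Ht).
    pose proof (Cmod_ge_0 c).
    destruct (Req_dec (Cmod c) 0) as [H3|H3]; [pose proof (Cmod_ge_0 (l t)); lra|].
    apply Rmult_le_reg_l with (Cmod c); nra.
Qed.

Definition convex (S : C -> Prop) : Prop :=
  forall (p q : C) (t : R), S p -> S q -> 0 <= t <= 1 -> S (p + t * (q - p)).

Lemma convex_disc (c : C) (r : R) : convex (disc c r).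
Proof.
  intros p q t Hp Hq Ht. unfold disc in *.
  replace (p + t * (q - p) - c) with ((1 - t)%R * (p - c) + t * (q - c)) by (rewrite RtoC_minus; ring).
  eapply Rle_lt_trans; [apply Cmod_triangle|]. rewrite !Cmod_mult, !Cmod_R, !Rabs_pos_eq by lra.
  destruct (Req_dec t 0); [subst; lra|].
  destruct (Req_dec t 1); [subst; lra|].
  nra.
Qed.

Lemma convex_and (S T : C -> Prop) : convex S -> convex T -> convex (fun z => S z /\ T z).
Proof. intros H1 H2 p q t [] [] Ht. split; auto. Qed.

Lemma cder_mvt (S : C -> Prop) (f l : C -> C) (M : R) (p q : C) :
  convex S -> S p -> S q ->
  (forall z, S z -> cder f z (l z)) -> (forall z, S z -> Cmod (l z) <= M) ->
  Cmod (f q - f p) <= M * Cmod (q - p).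
Proof.
  intros HS Hp Hq Hd HM.
  replace (f q - f p) with (f (p + 1%R * (q - p)) - f (p + 0%R * (q - p))) by (do 2 f_equal; f_equal; ring).
  apply (rder_mvt (fun s : R => f (p + s * (q - p))) (fun t => l (p + t * (q - p)) * (q - p))).
  - intros t Ht. now apply cder_rder, Hd, HS.
  - intros t Ht. rewrite Cmod_mult. apply Rmult_le_compat_r; [apply Cmod_ge_0|]. now apply HM, HS.
Qed.

(** The function [exp (- (c * s)) * N s] has a nonpositive derivative. *)
Lemma gronwall (N dN : R -> R) (c : R) :
  (forall t, 0 <= t <= 1 -> is_derive N t (dN t)) -> (forall t, 0 <= t <= 1 -> dN t <= c * N t) ->
  forall t, 0 <= t <= 1 -> N t <= exp (c * t) * N 0%R.
Proof.
  intros Hd Hb t Ht.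
  assert (Hder : forall s, 0 <= s <= 1 ->
    is_derive (fun s => exp (- (c * s)) * N s)%R s (exp (- (c * s)) * (dN s - c * N s))%R).
  { intros s Hs. specialize (Hd s Hs). auto_derive.
    - repeat split. now exists (dN s).
    - replace (Derive (fun x => N x) s) with (dN s) by (symmetry; exact (is_derive_unique _ _ _ Hd)). ring. }
  destruct (MVT_gen (fun s => exp (- (c * s)) * N s)%R 0 t
    (fun s => exp (- (c * s)) * (dN s - c * N s))%R) as [s [Hs Heq]].
  - intros s Hs. rewrite Rmin_left, Rmax_right in Hs by lra. apply Hder; lra.
  - intros s Hs. rewrite Rmin_left, Rmax_right in Hs by lra.
    apply derivable_continuous_pt. eexists. apply is_derive_Reals, Hder; lra.
  - rewrite Rmin_left, Rmax_right in Hs by lra.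
    rewrite Rmult_0_r, Ropp_0, exp_0 in Heq.
    pose proof (exp_pos (- (c * s))). pose proof (Hb s ltac:(lra)).
    assert (exp (- (c * s)) * (dN s - c * N s) * (t - 0) <= 0).
    { rewrite Rmult_assoc. apply Rmult_le_0_l; [lra|].
      apply Rmult_le_0_r; lra. }
    assert (exp (- (c * t)) * N t <= N 0%R) by lra.
    pose proof (exp_pos (c * t)).
    replace (N t) with (exp (c * t) * (exp (- (c * t)) * N t))%R.
    + apply Rmult_le_compat_l; lra.
    + rewrite <- Rmult_assoc, <- exp_plus, Rplus_opp_r, exp_0. ring.
Qed.

(** * Polynomial systems of two differential equations *)

(* Right-hand sides F(x, u, v) of a system u' = F1(x, u, v), v' = F2(x, u, v). *)
Inductive pexp : Type :=
| PConst (c : C) | PX | PU | PV | PAdd (a b : pexp) | PMul (a b : pexp).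

Fixpoint peval (F : pexp) (x u v : C) : C :=
  match F with
  | PConst c => c | PX => x | PU => u | PV => v
  | PAdd a b => peval a x u v + peval b x u v
  | PMul a b => peval a x u v * peval b x u v
  end.

Lemma peval_bounded (F : pexp) (K : R) : exists B, 0 <= B /\
  forall x u v, Cmod x <= K -> Cmod u <= K -> Cmod v <= K -> Cmod (peval F x u v) <= B.
Proof.
  induction F as [c| | | |a [A [HA Ha]] b [B [HB Hb]]|a [A [HA Ha]] b [B [HB Hb]]]; simpl.
  - exists (Cmod c). split; [apply Cmod_ge_0|]. intros. apply Rle_refl.
  - exists (Rabs K). split; [apply Rabs_pos|]. intros. pose proof (Rle_abs K). lra.
  - exists (Rabs K). split; [apply Rabs_pos|]. intros. pose proof (Rle_abs K). lra.
  - exists (Rabs K). split; [apply Rabs_pos|]. intros. pose proof (Rle_abs K). lra.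
  - exists (A + B)%R. split; [lra|]. intros x u v Hx Hu Hv.
    eapply Rle_trans; [apply Cmod_triangle|]. apply Rplus_le_compat; auto.
  - exists (A * B)%R. split; [nra|]. intros x u v Hx Hu Hv.
    rewrite Cmod_mult. apply Rmult_le_compat; auto using Cmod_ge_0.
Qed.

Lemma peval_lip (F : pexp) (K : R) : exists L, 0 <= L /\
  forall x u v x' u' v', Cmod x <= K -> Cmod u <= K -> Cmod v <= K ->
    Cmod x' <= K -> Cmod u' <= K -> Cmod v' <= K ->
    Cmod (peval F x u v - peval F x' u' v') <= L * (Cmod (x - x') + Cmod (u - u') + Cmod (v - v')).
Proof.
  induction F as [c| | | |a [A [HA Ha]] b [B [HB Hb]]|a [A [HA Ha]] b [B [HB Hb]]]; simpl.
  - exists 0%R. split; [lra|]. intros. replace (c - c) with (RtoC 0) by ring. rewrite Cmod_0. lra.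
  - exists 1%R. split; [lra|]. intros x u v x' u' v' _ _ _ _ _ _.
    pose proof (Cmod_ge_0 (u - u')). pose proof (Cmod_ge_0 (v - v')). lra.
  - exists 1%R. split; [lra|]. intros x u v x' u' v' _ _ _ _ _ _.
    pose proof (Cmod_ge_0 (x - x')). pose proof (Cmod_ge_0 (v - v')). lra.
  - exists 1%R. split; [lra|]. intros x u v x' u' v' _ _ _ _ _ _.
    pose proof (Cmod_ge_0 (x - x')). pose proof (Cmod_ge_0 (u - u')). lra.
  - exists (A + B)%R. split; [lra|]. intros x u v x' u' v' Hx Hu Hv Hx' Hu' Hv'.
    replace (peval a x u v + peval b x u v - (peval a x' u' v' + peval b x' u' v'))
      with ((peval a x u v - peval a x' u' v') + (peval b x u v - peval b x' u' v')) by ring.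
    eapply Rle_trans; [apply Cmod_triangle|]. rewrite Rmult_plus_distr_r.
    apply Rplus_le_compat; auto.
  - destruct (peval_bounded a K) as [MA [HMA Hma]]. destruct (peval_bounded b K) as [MB [HMB Hmb]].
    exists (A * MB + MA * B)%R. split; [nra|]. intros x u v x' u' v' Hx Hu Hv Hx' Hu' Hv'.
    replace (peval a x u v * peval b x u v - peval a x' u' v' * peval b x' u' v')
      with ((peval a x u v - peval a x' u' v') * peval b x u v + peval a x' u' v' * (peval b x u v - peval b x' u' v')) by ring.
    set (S := (Cmod (x - x') + Cmod (u - u') + Cmod (v - v'))%R).
    eapply Rle_trans; [apply Cmod_triangle|]. rewrite !Cmod_mult.
    replace ((A * MB + MA * B) * S)%R with ((A * S) * MB + MA * (B * S))%R by ring.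
    apply Rplus_le_compat; apply Rmult_le_compat; auto using Cmod_ge_0.
Qed.

(* Picard iterates of a polynomial system are polynomials, so they have explicit
   primitives and no path integrals are needed. *)
Inductive pol : Type := Mono (c : C) (n : nat) | Plus (p q : pol).

Fixpoint ev (p : pol) (z : C) : C :=
  match p with Mono c n => c * z ^ n | Plus p q => ev p z + ev q z end.

Fixpoint mulm (c : C) (n : nat) (p : pol) : pol :=
  match p with Mono d m => Mono (c * d) (n + m) | Plus p q => Plus (mulm c n p) (mulm c n q) end.

Fixpoint mulp (p q : pol) : pol :=
  match p with Mono c n => mulm c n q | Plus p p' => Plus (mulp p q) (mulp p' q) end.

Fixpoint prim (p : pol) : pol :=
  match p with Mono c n => Mono (c / INR (S n)) (S n) | Plus p q => Plus (prim p) (prim q) end.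

Lemma ev_mulm (c : C) (n : nat) (p : pol) (z : C) : ev (mulm c n p) z = c * z ^ n * ev p z.
Proof. induction p; simpl; [rewrite Cpow_add_r|rewrite IHp1, IHp2]; ring. Qed.

Lemma ev_mulp (p q : pol) (z : C) : ev (mulp p q) z = ev p z * ev q z.
Proof. induction p; simpl; [apply ev_mulm|rewrite IHp1, IHp2]; ring. Qed.

Lemma ev_prim_0 (p : pol) : ev (prim p) 0 = 0.
Proof. induction p; simpl; [|rewrite IHp1, IHp2]; ring. Qed.

Lemma RtoC_INR_neq_0 (n : nat) : RtoC (INR (S n)) <> 0.
Proof. intros H. apply RtoC_inj in H. now apply (not_0_INR (S n)). Qed.

Lemma cder_prim (p : pol) (x0 z : C) : cder (fun w => ev (prim p) (w - x0)) z (ev p (z - x0)).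
Proof.
  induction p; cbn [ev prim].
  - eapply cder_val; [|apply cder_mult; [apply cder_const|]].
    2:{ apply cder_pow, cder_minus; [apply cder_id|apply cder_const]. }
    cbn [pred]. pose proof (RtoC_INR_neq_0 n). field. auto.
  - now apply cder_plus.
Qed.

Fixpoint psubst (F : pexp) (x u v : pol) : pol :=
  match F with
  | PConst c => Mono c 0 | PX => x | PU => u | PV => v
  | PAdd a b => Plus (psubst a x u v) (psubst b x u v)
  | PMul a b => mulp (psubst a x u v) (psubst b x u v)
  end.

Lemma ev_psubst (F : pexp) (x u v : pol) (z : C) :
  ev (psubst F x u v) z = peval F (ev x z) (ev u z) (ev v z).
Proof.
  induction F; simpl; auto.
  - ring.
  - now rewrite IHF1, IHF2.
  - now rewrite ev_mulp, IHF1, IHF2.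
Qed.

Lemma Cmod_le_Re_Im (c : C) : Cmod c <= Rabs (Re c) + Rabs (Im c).
Proof.
  replace c with (Re c + Ci * Im c) at 1.
  - eapply Rle_trans; [apply Cmod_triangle|]. rewrite Cmod_mult, Cmod_Ci, !Cmod_R. lra.
  - destruct c. unfold Ci, Cplus, Cmult. simpl. f_equal; ring.
Qed.

Lemma half_pow_small (eps : R) : 0 < eps -> exists N, forall n, (N <= n)%nat -> (1/2) ^ n < eps.
Proof.
  intros He. destruct (pow_lt_1_zero (1/2) ltac:(rewrite Rabs_pos_eq; lra) eps He) as [N HN].
  exists N. intros n Hn. specialize (HN n Hn). rewrite Rabs_pos_eq in HN; [exact HN|].
  apply pow_le; lra.
Qed.

Lemma le_of_le_half_pow (a b k : R) : (forall n, a <= b + k * (1/2) ^ n) -> a <= b.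
Proof.
  intros H. apply le_epsilon. intros eps He.
  destruct (half_pow_small (eps / (Rabs k + 1))) as [N HN].
  { pose proof (Rabs_pos k). apply Rdiv_lt_0_compat; lra. }
  specialize (HN N (Nat.le_refl _)). specialize (H N).
  pose proof (Rabs_pos k). pose proof (Rle_abs k).
  assert (0 <= (1/2) ^ N) by (apply pow_le; lra).
  assert ((1/2) ^ N * (Rabs k + 1) < eps).
  { apply Rlt_le_trans with (eps / (Rabs k + 1) * (Rabs k + 1))%R.
    apply Rmult_lt_compat_r; lra. right; field; lra. }
  nra.
Qed.

(** Built on the total [Lim_seq], so that limit functions are defined on all of C, with junk values
    where the sequence diverges. *)
Definition climit (c : nat -> C) : C :=
  (real (Lim_seq (fun n => Re (c n))), real (Lim_seq (fun n => Im (c n)))).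

Lemma climit_geometric (c : nat -> C) :
  (forall n, Cmod (c (S n) - c n) <= (1/2) ^ n) ->
  forall n, Cmod (c n - climit c) <= 2 * (1/2) ^ n.
Proof.
  intros H.
  (* Telescoping with the exact geometric sum; the subtracted term is what lets the induction on [k]
     close. *)
  assert (Hc : forall n k, Cmod (c (n + k)%nat - c n) <= 2 * (1/2) ^ n - (2 * (1/2) ^ n) * (1/2) ^ k).
  { intros n k. induction k as [|k IH].
    - rewrite Nat.add_0_r. replace (c n - c n) with (RtoC 0) by ring. rewrite Cmod_0. simpl. lra.
    - replace (n + S k)%nat with (S (n + k)) by lia.
      replace (c (S (n + k)) - c n) with ((c (S (n + k)) - c (n + k)%nat) + (c (n + k)%nat - c n)) by ring.
      eapply Rle_trans; [apply Cmod_triangle|]. pose proof (H (n + k)%nat). rewrite pow_add in H0. simpl. lra. }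
  assert (Hc' : forall n m, (n <= m)%nat -> Cmod (c m - c n) <= 2 * (1/2) ^ n).
  { intros n m Hnm. replace m with (n + (m - n))%nat by lia. eapply Rle_trans; [apply Hc|].
    assert (0 <= (1/2) ^ n) by (apply pow_le; lra). assert (0 <= (1/2) ^ (m - n)) by (apply pow_le; lra).
    nra. }
  assert (Hlim : forall h : C -> R, (forall a b, h (a - b) = (h a - h b)%R) ->
    (forall a, Rabs (h a) <= Cmod a) ->
    is_lim_seq (fun n => h (c n)) (real (Lim_seq (fun n => h (c n))))).
  { intros h Hh1 Hh2. apply Lim_seq_correct', ex_lim_seq_cauchy_corr.
    intros eps. destruct (half_pow_small (eps / 4)) as [N HN].
    { pose proof (cond_pos eps). lra. }
    exists N. intros n m Hn Hm. rewrite <- Hh1. eapply Rle_lt_trans; [apply Hh2|].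
    replace (c n - c m) with ((c n - c N) - (c m - c N)) by ring.
    eapply Rle_lt_trans; [apply Cmod_triangle_minus|].
    pose proof (Hc' N n Hn). pose proof (Hc' N m Hm). pose proof (HN N (Nat.le_refl _)). lra. }
  pose proof (Hlim Re (fun _ _ => eq_refl) re_le_Cmod) as HR.
  pose proof (Hlim Im (fun _ _ => eq_refl) im_le_Cmod) as HI.
  intros n. apply le_epsilon. intros eps He.
  apply is_lim_seq_spec in HR, HI.
  destruct (HR (mkposreal (eps / 2) ltac:(lra))) as [N1 H1].
  destruct (HI (mkposreal (eps / 2) ltac:(lra))) as [N2 H2]. simpl in H1, H2.
  set (m := (n + N1 + N2)%nat).
  specialize (H1 m ltac:(lia)). specialize (H2 m ltac:(lia)).
  replace (c n - climit c) with ((c m - climit c) - (c m - c n)) by ring.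
  eapply Rle_trans; [apply Cmod_triangle_minus|].
  pose proof (Hc' n m ltac:(lia)). pose proof (Cmod_le_Re_Im (c m - climit c)).
  change (Re (c m - climit c)) with (Re (c m) - real (Lim_seq (fun n => Re (c n))))%R in H3.
  change (Im (c m - climit c)) with (Im (c m) - real (Lim_seq (fun n => Im (c n))))%R in H3.
  lra.
Qed.

Definition sys (F1 F2 : pexp) (u v : C -> C) (z : C) : Prop :=
  cder u z (peval F1 z (u z) (v z)) /\ cder v z (peval F2 z (u z) (v z)).

(* The uniform Lipschitz bound B on the iterates makes the difference quotients of
   W_n converge uniformly in n, so differentiability passes to the limit. *)
Lemma limit_solves (F : pexp) (K L B r : R) (x0 : C) (P Q W : nat -> C -> C) (u v w : C -> C) :
  0 <= L -> 0 <= B ->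
  (forall x u v x' u' v', Cmod x <= K -> Cmod u <= K -> Cmod v <= K ->
    Cmod x' <= K -> Cmod u' <= K -> Cmod v' <= K ->
    Cmod (peval F x u v - peval F x' u' v') <= L * (Cmod (x - x') + Cmod (u - u') + Cmod (v - v'))) ->
  (forall z, disc x0 r z -> Cmod z <= K /\ Cmod (u z) <= K /\ Cmod (v z) <= K) ->
  (forall n z, disc x0 r z -> Cmod (P n z) <= K /\ Cmod (Q n z) <= K) ->
  (forall n z z', disc x0 r z -> disc x0 r z' ->
    Cmod (P n z - P n z') <= B * Cmod (z - z') /\ Cmod (Q n z - Q n z') <= B * Cmod (z - z')) ->
  (forall n z, disc x0 r z -> cder (W (S n)) z (peval F z (P n z) (Q n z))) ->
  (forall n z, disc x0 r z -> Cmod (P n z - u z) <= 2 * (1/2) ^ n) ->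
  (forall n z, disc x0 r z -> Cmod (Q n z - v z) <= 2 * (1/2) ^ n) ->
  (forall n z, disc x0 r z -> Cmod (W n z - w z) <= 2 * (1/2) ^ n) ->
  forall z, disc x0 r z -> cder w z (peval F z (u z) (v z)).
Proof.
  intros HL HB Hlip Hbu HbP Hlp Hder HPu HQv HWw z Hz eps He.
  destruct (disc_open x0 r z Hz) as [d [Hd Hsub]].
  (* A Lipschitz constant for s |-> F(s, P_n s, Q_n s), the same for all n. *)
  set (M := (L * (1 + 2 * B))%R). assert (HM : 0 <= M) by (unfold M; nra).
  assert (He' : 0 < eps / (M + 1)) by (apply Rdiv_lt_0_compat; lra).
  exists (Rmin d (eps / (M + 1))). split; [now apply Rmin_pos|].
  intros y Hy.
  assert (HyD : disc x0 r y).
  { apply Hsub. unfold disc in *. pose proof (Rmin_l d (eps / (M + 1))). lra. }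
  assert (Hn : forall n, Cmod (W (S n) y - W (S n) z - peval F z (P n z) (Q n z) * (y - z)) <= eps * Cmod (y - z)).
  { intros n. set (A := peval F z (P n z) (Q n z)).
    replace (W (S n) y - W (S n) z - A * (y - z)) with ((W (S n) y - A * y) - (W (S n) z - A * z)) by ring.
    (* The slope is frozen at [z]: on the convex set [D] the derivative of [W (S n) s - A * s] has
       modulus at most [eps], and the mean value inequality applies. *)
    set (D := fun s => disc x0 r s /\ disc z (Rmin d (eps / (M + 1))) s).
    apply (cder_mvt D (fun s => W (S n) s - A * s) (fun s => peval F s (P n s) (Q n s) - A)).
    - apply convex_and; apply convex_disc.
    - split; [exact Hz|]. apply disc_center. now apply Rmin_pos.
    - now split.
    - intros s [Hs _]. apply cder_minus; [now apply Hder|apply cder_scal].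
    - intros s [Hs Hs2]. unfold A.
      destruct (Hbu s Hs) as [? _]. destruct (Hbu z Hz) as [? _].
      destruct (HbP n s Hs). destruct (HbP n z Hz). destruct (Hlp n s z Hs Hz).
      eapply Rle_trans; [apply Hlip; assumption|].
      unfold disc in Hs2. pose proof (Rmin_r d (eps / (M + 1))).
      apply Rle_trans with (M * Cmod (s - z))%R.
      { unfold M. rewrite Rmult_assoc. apply Rmult_le_compat_l; lra. }
      apply Rle_trans with ((M + 1) * (eps / (M + 1)))%R.
      { pose proof (Cmod_ge_0 (s - z)). apply Rmult_le_compat; lra. }
      right; field; lra. }
  apply (le_of_le_half_pow _ _ (2 + L * 4 * Cmod (y - z))). intros n.
  replace (w y - w z - peval F z (u z) (v z) * (y - z)) with
    ((W (S n) y - W (S n) z - peval F z (P n z) (Q n z) * (y - z)) -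
     ((W (S n) y - w y) - (W (S n) z - w z) - (peval F z (P n z) (Q n z) - peval F z (u z) (v z)) * (y - z))) by ring.
  eapply Rle_trans; [apply Cmod_triangle_minus|].
  apply Rle_trans with (eps * Cmod (y - z) + (2 * (1/2) ^ (S n) + 2 * (1/2) ^ (S n) + L * (4 * (1/2) ^ n) * Cmod (y - z)))%R.
  2:{ cbn [pow]. right. field. }
  apply Rplus_le_compat; [apply Hn|].
  eapply Rle_trans; [apply Cmod_triangle_minus|]. apply Rplus_le_compat.
  { eapply Rle_trans; [apply Cmod_triangle_minus|]. apply Rplus_le_compat; auto. }
  rewrite Cmod_mult. apply Rmult_le_compat_r; [apply Cmod_ge_0|].
  destruct (Hbu z Hz) as [? [? ?]]. destruct (HbP n z Hz).
  eapply Rle_trans; [apply Hlip; assumption|].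
  apply Rmult_le_compat_l; [exact HL|].
  replace (z - z) with (RtoC 0) by ring. rewrite Cmod_0.
  pose proof (HPu n z Hz). pose proof (HQv n z Hz). lra.
Qed.

(** The polynomials are in the increment z - x0, so x itself becomes [Plus (Mono x0 0) (Mono 1 1)],
    and [prim], which vanishes at 0, preserves the initial values. *)
Fixpoint picard (F1 F2 : pexp) (x0 u0 v0 : C) (n : nat) : pol * pol :=
  match n with
  | O => (Mono u0 0, Mono v0 0)
  | S n =>
      let (p, q) := picard F1 F2 x0 u0 v0 n in
      let x := Plus (Mono x0 0) (Mono 1 1) in
      (Plus (Mono u0 0) (prim (psubst F1 x p q)), Plus (Mono v0 0) (prim (psubst F2 x p q)))
  end.

(** Picard iteration. The radius is fixed before the initial data and depends on the bound [K]
    alone; this is what later turns bounds on chart coordinates into continuation by a uniform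
    amount. *)
Lemma ode_exists (F1 F2 : pexp) (K : R) :
  exists r, 0 < r /\ forall x0 u0 v0, Cmod x0 <= K -> Cmod u0 <= K -> Cmod v0 <= K ->
    exists u v : C -> C, u x0 = u0 /\ v x0 = v0 /\ forall z, disc x0 r z -> sys F1 F2 u v z.
Proof.
  (* Iterates stay within 1 of the initial values, limits within 2, and |z| exceeds |x0| by less
     than 1, so [K + 3] bounds every argument of [F1] and [F2]. *)
  destruct (peval_bounded F1 (K + 3)) as [B1 [HB1 Hb1]].
  destruct (peval_bounded F2 (K + 3)) as [B2 [HB2 Hb2]].
  destruct (peval_lip F1 (K + 3)) as [L1 [HL1 Hl1]].
  destruct (peval_lip F2 (K + 3)) as [L2 [HL2 Hl2]].
  set (B := (B1 + B2)%R). set (L := (L1 + L2)%R).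
  assert (HB : 0 <= B) by (unfold B; lra). assert (HL : 0 <= L) by (unfold L; lra).
  (* Now r B <= 1/4 keeps the iterates near the initial values, and r L <= 1/4 makes their
     differences shrink by 2 r L <= 1/2, the factor 2 coming from the two components. *)
  set (r := (/ (4 * (1 + B + L)))%R).
  assert (Hr : 0 < r) by (apply Rinv_0_lt_compat; lra).
  assert (Hr1 : (r * (4 * (1 + B + L)))%R = 1%R) by (unfold r; field; lra).
  exists r. split; [exact Hr|]. intros x0 u0 v0 Hx0 Hu0 Hv0.
  set (P := fun n z => ev (fst (picard F1 F2 x0 u0 v0 n)) (z - x0)).
  set (Q := fun n z => ev (snd (picard F1 F2 x0 u0 v0 n)) (z - x0)).
  assert (HP0 : forall z, P 0%nat z = u0) by (intros; unfold P; simpl; ring).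
  assert (HQ0 : forall z, Q 0%nat z = v0) by (intros; unfold Q; simpl; ring).
  assert (HPx : forall n, P n x0 = u0 /\ Q n x0 = v0).
  { intros [|n]; [auto|]. unfold P, Q. simpl. destruct (picard F1 F2 x0 u0 v0 n) as [p q]. simpl.
    replace (x0 - x0) with (RtoC 0) by ring. rewrite !ev_prim_0. split; ring. }
  assert (HdP : forall n z, cder (P (S n)) z (peval F1 z (P n z) (Q n z)) /\ cder (Q (S n)) z (peval F2 z (P n z) (Q n z))).
  { intros n z. unfold P, Q. simpl. destruct (picard F1 F2 x0 u0 v0 n) as [p q]. cbn [fst snd].
    set (X := Plus (Mono x0 0) (Mono 1 1)).
    assert (HX : ev X (z - x0) = z) by (unfold X; simpl; ring).
    split.
    - apply cder_val with (0 + ev (psubst F1 X p q) (z - x0)).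
      { rewrite ev_psubst, HX. ring. }
      exact (cder_plus (fun w => u0 * 1) _ z _ _ (cder_const (u0 * 1) z) (cder_prim (psubst F1 X p q) x0 z)).
    - apply cder_val with (0 + ev (psubst F2 X p q) (z - x0)).
      { rewrite ev_psubst, HX. ring. }
      exact (cder_plus (fun w => v0 * 1) _ z _ _ (cder_const (v0 * 1) z) (cder_prim (psubst F2 X p q) x0 z)). }
  assert (Hc := disc_center x0 r Hr).
  assert (HzK : forall z, disc x0 r z -> Cmod z <= K + 3).
  { intros z Hz. unfold disc in Hz. replace z with ((z - x0) + x0) by ring.
    eapply Rle_trans; [apply Cmod_triangle|]. nra. }
  assert (Hnear : forall a b k, Cmod (a - b) <= k -> Cmod b <= K -> k <= 3 -> Cmod a <= K + 3).
  { intros a b k H1 H2 H3. replace a with ((a - b) + b) by ring.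
    eapply Rle_trans; [apply Cmod_triangle|]. lra. }
  assert (Hbd : forall n z, disc x0 r z -> Cmod (P n z - u0) <= 1 /\ Cmod (Q n z - v0) <= 1).
  { induction n as [|n IH].
    - intros z _. rewrite HP0, HQ0. replace (u0 - u0) with (RtoC 0) by ring.
      replace (v0 - v0) with (RtoC 0) by ring. rewrite Cmod_0. lra.
    - intros z Hz. destruct (HPx (S n)) as [E1 E2].
      rewrite <- E1 at 1. rewrite <- E2 at 1.
      assert (Hz' := Hz). unfold disc in Hz'. pose proof (Cmod_ge_0 (z - x0)).
      split.
      + apply Rle_trans with (B * Cmod (z - x0))%R; [|nra].
        apply (cder_mvt (disc x0 r) _ (fun s => peval F1 s (P n s) (Q n s))); auto using convex_disc.
        * intros; apply HdP.
        * intros s Hs. destruct (IH s Hs). apply Rle_trans with B1; [|unfold B; lra].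
          apply Hb1; [auto|apply Hnear with u0 1%R; auto; lra|apply Hnear with v0 1%R; auto; lra].
      + apply Rle_trans with (B * Cmod (z - x0))%R; [|nra].
        apply (cder_mvt (disc x0 r) _ (fun s => peval F2 s (P n s) (Q n s))); auto using convex_disc.
        * intros; apply HdP.
        * intros s Hs. destruct (IH s Hs). apply Rle_trans with B2; [|unfold B; lra].
          apply Hb2; [auto|apply Hnear with u0 1%R; auto; lra|apply Hnear with v0 1%R; auto; lra]. }
  assert (HbK : forall n z, disc x0 r z -> Cmod (P n z) <= K + 3 /\ Cmod (Q n z) <= K + 3).
  { intros n z Hz. destruct (Hbd n z Hz).
    split; [apply Hnear with u0 1%R|apply Hnear with v0 1%R]; auto; lra. }
  assert (Hlp : forall n z z', disc x0 r z -> disc x0 r z' ->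
    Cmod (P n z - P n z') <= B * Cmod (z - z') /\ Cmod (Q n z - Q n z') <= B * Cmod (z - z')).
  { intros [|n] z z' Hz Hz'.
    - rewrite !HP0, !HQ0. replace (u0 - u0) with (RtoC 0) by ring.
      replace (v0 - v0) with (RtoC 0) by ring. rewrite Cmod_0. pose proof (Cmod_ge_0 (z - z')). nra.
    - split.
      + apply (cder_mvt (disc x0 r) _ (fun s => peval F1 s (P n s) (Q n s))); auto using convex_disc.
        * intros; apply HdP.
        * intros s Hs. destruct (HbK n s Hs). apply Rle_trans with B1; [|unfold B; lra]. auto.
      + apply (cder_mvt (disc x0 r) _ (fun s => peval F2 s (P n s) (Q n s))); auto using convex_disc.
        * intros; apply HdP.
        * intros s Hs. destruct (HbK n s Hs). apply Rle_trans with B2; [|unfold B; lra]. auto. }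
  assert (Hdiff : forall n z, disc x0 r z ->
    Cmod (P (S n) z - P n z) <= (1/2) ^ n /\ Cmod (Q (S n) z - Q n z) <= (1/2) ^ n).
  { induction n as [|n IH].
    - intros z Hz. rewrite HP0, HQ0. simpl pow. now apply Hbd.
    - intros z Hz.
      assert (Hz' := Hz). unfold disc in Hz'. pose proof (Cmod_ge_0 (z - x0)).
      assert (Hpow : 0 <= (1/2) ^ n) by (apply pow_le; lra).
      assert (Hfin : L * (2 * (1/2) ^ n) * Cmod (z - x0) <= (1/2) ^ (S n)).
      { simpl pow. assert (L * Cmod (z - x0) <= 1/4) by nra. nra. }
      split; (eapply Rle_trans; [|exact Hfin]).
      + destruct (HPx (S n)) as [E1 _]. destruct (HPx (S (S n))) as [E2 _].
        replace (P (S (S n)) z - P (S n) z) with ((P (S (S n)) z - P (S n) z) - (P (S (S n)) x0 - P (S n) x0))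
          by (rewrite E1, E2; ring).
        apply (cder_mvt (disc x0 r) (fun s => P (S (S n)) s - P (S n) s)
          (fun s => peval F1 s (P (S n) s) (Q (S n) s) - peval F1 s (P n s) (Q n s))); auto using convex_disc.
        * intros s Hs. apply cder_minus; apply HdP.
        * intros s Hs. destruct (HbK n s Hs), (HbK (S n) s Hs), (IH s Hs).
          eapply Rle_trans; [apply Hl1; auto|].
          replace (s - s) with (RtoC 0) by ring. rewrite Cmod_0.
          pose proof (Cmod_ge_0 (P (S n) s - P n s)). pose proof (Cmod_ge_0 (Q (S n) s - Q n s)).
          apply Rmult_le_compat; unfold L; lra.
      + destruct (HPx (S n)) as [_ E1]. destruct (HPx (S (S n))) as [_ E2].
        replace (Q (S (S n)) z - Q (S n) z) with ((Q (S (S n)) z - Q (S n) z) - (Q (S (S n)) x0 - Q (S n) x0))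
          by (rewrite E1, E2; ring).
        apply (cder_mvt (disc x0 r) (fun s => Q (S (S n)) s - Q (S n) s)
          (fun s => peval F2 s (P (S n) s) (Q (S n) s) - peval F2 s (P n s) (Q n s))); auto using convex_disc.
        * intros s Hs. apply cder_minus; apply HdP.
        * intros s Hs. destruct (HbK n s Hs), (HbK (S n) s Hs), (IH s Hs).
          eapply Rle_trans; [apply Hl2; auto|].
          replace (s - s) with (RtoC 0) by ring. rewrite Cmod_0.
          pose proof (Cmod_ge_0 (P (S n) s - P n s)). pose proof (Cmod_ge_0 (Q (S n) s - Q n s)).
          apply Rmult_le_compat; unfold L; lra. }
  set (u := fun z => climit (fun n => P n z)). set (v := fun z => climit (fun n => Q n z)).
  assert (Hu : forall n z, disc x0 r z -> Cmod (P n z - u z) <= 2 * (1/2) ^ n).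
  { intros n z Hz. apply (climit_geometric (fun n => P n z)). intros k. now apply Hdiff. }
  assert (Hv : forall n z, disc x0 r z -> Cmod (Q n z - v z) <= 2 * (1/2) ^ n).
  { intros n z Hz. apply (climit_geometric (fun n => Q n z)). intros k. now apply Hdiff. }
  assert (HuvK : forall z, disc x0 r z -> Cmod z <= K + 3 /\ Cmod (u z) <= K + 3 /\ Cmod (v z) <= K + 3).
  { intros z Hz. pose proof (Hu 0%nat z Hz) as A1. pose proof (Hv 0%nat z Hz) as A2.
    rewrite HP0 in A1. rewrite HQ0 in A2. rewrite Cmod_minus_sym in A1, A2. simpl in A1, A2.
    split; [auto|]. split; [apply Hnear with u0 2%R|apply Hnear with v0 2%R]; auto; lra. }
  exists u, v. split; [|split].
  - assert (Cmod (u0 - u x0) <= 0).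
    { apply (le_of_le_half_pow _ _ 2). intros n. rewrite Rplus_0_l.
      destruct (HPx n) as [E _]. rewrite <- E at 1. now apply Hu. }
    symmetry. assert (E : u0 - u x0 = 0) by (apply Cmod_eq_0; pose proof (Cmod_ge_0 (u0 - u x0)); lra).
    replace u0 with ((u0 - u x0) + u x0) by ring. rewrite E. ring.
  - assert (Cmod (v0 - v x0) <= 0).
    { apply (le_of_le_half_pow _ _ 2). intros n. rewrite Rplus_0_l.
      destruct (HPx n) as [_ E]. rewrite <- E at 1. now apply Hv. }
    symmetry. assert (E : v0 - v x0 = 0) by (apply Cmod_eq_0; pose proof (Cmod_ge_0 (v0 - v x0)); lra).
    replace v0 with ((v0 - v x0) + v x0) by ring. rewrite E. ring.
  - intros z Hz. split.
    + apply (limit_solves F1 (K + 3) L1 B r x0 P Q P u v u); auto. intros; apply HdP.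
    + apply (limit_solves F2 (K + 3) L2 B r x0 P Q Q u v v); auto. intros; apply HdP.
Qed.

(** * Uniqueness along a segment *)

Lemma rder_minus (g h : R -> C) (t : R) (l m : C) :
  rder g t l -> rder h t m -> rder (fun s => g s - h s) t (l - m).
Proof.
  intros [H1 H2] [H3 H4]. split.
  - exact (is_derive_minus (V := R_NormedModule) _ _ _ _ _ H1 H3).
  - exact (is_derive_minus (V := R_NormedModule) _ _ _ _ _ H2 H4).
Qed.

Lemma is_derive_sum_sq (h k : R -> R) (t a b : R) :
  is_derive h t a -> is_derive k t b ->
  is_derive (fun s => h s ^ 2 + k s ^ 2)%R t (2 * (h t * a + k t * b))%R.
Proof.
  intros H1 H2. auto_derive.
  - repeat split; [now exists a|now exists b].
  - replace (Derive (fun x => h x) t) with a by (symmetry; exact (is_derive_unique _ _ _ H1)).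
    replace (Derive (fun x => k x) t) with b by (symmetry; exact (is_derive_unique _ _ _ H2)).
    ring.
Qed.

Lemma rder_Cmod2 (g : R -> C) (t : R) (l : C) : rder g t l ->
  is_derive (fun s => Cmod (g s) ^ 2)%R t (2 * (Re (g t) * Re l + Im (g t) * Im l))%R.
Proof.
  intros [H1 H2].
  apply is_derive_ext with (fun s => Re (g s) ^ 2 + Im (g s) ^ 2)%R.
  { intros s. now rewrite Cmod2_alt. }
  exact (is_derive_sum_sq _ _ t _ _ H1 H2).
Qed.

Lemma rder_bounded (g l : R -> C) : (forall t, 0 <= t <= 1 -> rder g t (l t)) ->
  exists K, forall t, 0 <= t <= 1 -> Cmod (g t) <= K.
Proof.
  intros H.
  (* The squared modulus is differentiable even where [g] vanishes, hence continuous, and attains a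
     maximum. *)
  destruct (continuity_ab_maj (fun s => Cmod (g s) ^ 2)%R 0 1) as [m [Hm _]].
  - lra.
  - intros t Ht. apply derivable_continuous_pt. eexists.
    apply is_derive_Reals, rder_Cmod2, H, Ht.
  - exists (1 + Cmod (g m) ^ 2)%R. intros t Ht. specialize (Hm t Ht). nra.
Qed.

(** Gronwall's inequality for the squared distance |u - u'|^2 + |v - v'|^2, which is 0 at [p]. The
    systems are assumed on the segment only, so that the lemma applies to segments avoiding a
    pole. *)
Lemma ode_unique (F1 F2 : pexp) (u v u' v' : C -> C) (p q : C) :
  (forall t, 0 <= t <= 1 -> sys F1 F2 u v (p + t * (q - p))) ->
  (forall t, 0 <= t <= 1 -> sys F1 F2 u' v' (p + t * (q - p))) ->
  u p = u' p -> v p = v' p -> u q = u' q /\ v q = v' q.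
Proof.
  intros H H' Hu Hv. set (y := fun t : R => p + t * (q - p)).
  assert (Hbd : forall f g, (forall t, 0 <= t <= 1 -> cder f (y t) (g t)) ->
    exists K, forall t, 0 <= t <= 1 -> Cmod (f (y t)) <= K).
  { intros f g Hf. apply (rder_bounded (fun t => f (y t)) (fun t => g t * (q - p))).
    intros t Ht. apply cder_rder, Hf, Ht. }
  destruct (Hbd (fun z => z) (fun _ => RtoC 1)) as [K0 HK0]; [intros; apply cder_id|].
  destruct (Hbd u (fun t => peval F1 (y t) (u (y t)) (v (y t)))) as [K1 HK1]; [intros; now apply H|].
  destruct (Hbd v (fun t => peval F2 (y t) (u (y t)) (v (y t)))) as [K2 HK2]; [intros; now apply H|].
  destruct (Hbd u' (fun t => peval F1 (y t) (u' (y t)) (v' (y t)))) as [K3 HK3]; [intros; now apply H'|].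
  destruct (Hbd v' (fun t => peval F2 (y t) (u' (y t)) (v' (y t)))) as [K4 HK4]; [intros; now apply H'|].
  clear Hbd.
  set (K := (Rabs K0 + Rabs K1 + Rabs K2 + Rabs K3 + Rabs K4)%R).
  assert (HK : K0 <= K /\ K1 <= K /\ K2 <= K /\ K3 <= K /\ K4 <= K).
  { pose proof (Rle_abs K0); pose proof (Rle_abs K1); pose proof (Rle_abs K2);
    pose proof (Rle_abs K3); pose proof (Rle_abs K4);
    pose proof (Rabs_pos K0); pose proof (Rabs_pos K1); pose proof (Rabs_pos K2);
    pose proof (Rabs_pos K3); pose proof (Rabs_pos K4). unfold K. repeat split; lra. }
  destruct HK as [HK0' [HK1' [HK2' [HK3' HK4']]]].
  destruct (peval_lip F1 K) as [L1 [HL1 Hl1]]. destruct (peval_lip F2 K) as [L2 [HL2 Hl2]].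
  set (e := Cmod (q - p)). assert (He : 0 <= e) by apply Cmod_ge_0.
  set (a := fun t => u (y t) - u' (y t)). set (b := fun t => v (y t) - v' (y t)).
  set (da := fun t => (peval F1 (y t) (u (y t)) (v (y t)) - peval F1 (y t) (u' (y t)) (v' (y t))) * (q - p)).
  set (db := fun t => (peval F2 (y t) (u (y t)) (v (y t)) - peval F2 (y t) (u' (y t)) (v' (y t))) * (q - p)).
  assert (Hda : forall t, 0 <= t <= 1 -> rder a t (da t)).
  { intros t Ht. destruct (H t Ht) as [A1 _], (H' t Ht) as [A2 _].
    replace (da t) with (peval F1 (y t) (u (y t)) (v (y t)) * (q - p) - peval F1 (y t) (u' (y t)) (v' (y t)) * (q - p)) by (unfold da; ring).
    apply rder_minus; now apply cder_rder. }
  assert (Hdb : forall t, 0 <= t <= 1 -> rder b t (db t)).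
  { intros t Ht. destruct (H t Ht) as [_ A1], (H' t Ht) as [_ A2].
    replace (db t) with (peval F2 (y t) (u (y t)) (v (y t)) * (q - p) - peval F2 (y t) (u' (y t)) (v' (y t)) * (q - p)) by (unfold db; ring).
    apply rder_minus; now apply cder_rder. }
  (* With A and B the moduli of the two differences, the constant comes from 2 A (A + B) L1 e + 2 B
     (A + B) L2 e <= 4 (L1 + L2) e (A^2 + B^2). *)
  assert (HG : forall t, 0 <= t <= 1 -> Cmod (a t) ^ 2 + Cmod (b t) ^ 2 <=
    exp (4 * (L1 + L2) * e * t) * (Cmod (a 0%R) ^ 2 + Cmod (b 0%R) ^ 2)).
  { intros t Ht.
    apply (gronwall (fun t => Cmod (a t) ^ 2 + Cmod (b t) ^ 2)%R
      (fun t => 2 * (Re (a t) * Re (da t) + Im (a t) * Im (da t)) + 2 * (Re (b t) * Re (db t) + Im (b t) * Im (db t)))%R); [| |exact Ht].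
    - intros s Hs. apply (is_derive_plus (V := R_NormedModule)); apply rder_Cmod2; auto.
    - intros s Hs.
      pose proof (Re_conj_mul_le (a s) (da s)) as E1. pose proof (Re_conj_mul_le (b s) (db s)) as E2.
      assert (D1 : Cmod (da s) <= L1 * (Cmod (a s) + Cmod (b s)) * e).
      { unfold da. rewrite Cmod_mult. apply Rmult_le_compat_r; [exact He|].
        eapply Rle_trans; [apply Hl1; (eapply Rle_trans; [eauto|assumption])|].
        replace (y s - y s) with (RtoC 0) by ring. rewrite Cmod_0. right. unfold a, b. ring. }
      assert (D2 : Cmod (db s) <= L2 * (Cmod (a s) + Cmod (b s)) * e).
      { unfold db. rewrite Cmod_mult. apply Rmult_le_compat_r; [exact He|].
        eapply Rle_trans; [apply Hl2; (eapply Rle_trans; [eauto|assumption])|].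
        replace (y s - y s) with (RtoC 0) by ring. rewrite Cmod_0. right. unfold a, b. ring. }
      pose proof (Cmod_ge_0 (a s)). pose proof (Cmod_ge_0 (b s)).
      set (A := Cmod (a s)) in *. set (B := Cmod (b s)) in *.
      assert (F1' : A * Cmod (da s) <= A * (L1 * (A + B) * e)) by (apply Rmult_le_compat_l; lra).
      assert (F2' : B * Cmod (db s) <= B * (L2 * (A + B) * e)) by (apply Rmult_le_compat_l; lra).
      assert (0 <= L1 * e) by (apply Rmult_le_pos; lra).
      assert (0 <= L2 * e) by (apply Rmult_le_pos; lra).
      assert (A * (A + B) <= 2 * (A ^ 2 + B ^ 2)) by nra.
      assert (B * (A + B) <= 2 * (A ^ 2 + B ^ 2)) by nra.
      nra. }
  assert (Hy0 : y 0%R = p) by (unfold y; ring). assert (Hy1 : y 1%R = q) by (unfold y; ring).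
  specialize (HG 1%R ltac:(lra)). unfold a, b in HG. rewrite Hy0, Hy1, Hu, Hv in HG.
  replace (u' p - u' p) with (RtoC 0) in HG by ring. replace (v' p - v' p) with (RtoC 0) in HG by ring.
  rewrite Cmod_0 in HG.
  assert (Z : forall w z : C, Cmod (w - z) = 0%R -> w = z).
  { intros w z E. apply Cmod_eq_0 in E. replace w with ((w - z) + z) by ring. rewrite E. ring. }
  pose proof (Cmod_ge_0 (u q - u' q)). pose proof (Cmod_ge_0 (v q - v' q)).
  split; apply Z; nra.
Qed.

(** * Convex sets are connected *)

Lemma line_near (p e : C) (T d : R) : 0 < d ->
  exists eta, 0 < eta /\ forall s, Rabs (s - T) < eta -> disc (p + T * e) d (p + s * e).
Proof.
  intros Hd. pose proof (Cmod_ge_0 e). exists (d / (Cmod e + 1))%R.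
  split; [apply Rdiv_lt_0_compat; lra|]. intros s Hs. unfold disc.
  replace ((p + s * e) - (p + T * e)) with (RtoC (s - T) * e) by (rewrite RtoC_minus; ring).
  rewrite Cmod_mult, Cmod_R. pose proof (Rabs_pos (s - T)).
  apply Rle_lt_trans with (Rabs (s - T) * (Cmod e + 1))%R; [nra|].
  apply Rlt_le_trans with (d / (Cmod e + 1) * (Cmod e + 1))%R.
  - apply Rmult_lt_compat_r; lra.
  - right; field; lra.
Qed.

(** Let T be the supremum of the parameters up to which the segment from a point of [A] to a point
    of [B] stays in [A]. If no point of [S] lies in both sets, openness of the one containing the
    point at T contradicts the choice of T. *)
Lemma convex_connected (S : C -> Prop) : convex S -> C_connected S.
Proof.
  intros HS A B HA HB Hcov [zA [SA AzA]] [zB [SB BzB]].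
  apply NNPP. intros Hno.
  set (y := fun t : R => zA + t * (zB - zA)).
  assert (HSy : forall t, 0 <= t <= 1 -> S (y t)) by (intros; now apply HS).
  set (E := fun t => 0 <= t <= 1 /\ forall s, 0 <= s <= t -> A (y s)).
  assert (Hy0 : y 0%R = zA) by (unfold y; ring). assert (Hy1 : y 1%R = zB) by (unfold y; ring).
  assert (E0 : E 0%R).
  { split; [lra|]. intros s Hs. replace s with 0%R by lra. now rewrite Hy0. }
  destruct (completeness E) as [T [HT1 HT2]].
  { exists 1%R. intros t [Ht _]. lra. }
  { now exists 0%R. }
  assert (HT : 0 <= T <= 1).
  { split; [now apply HT1|]. apply HT2. intros t [Ht _]. lra. }
  assert (Hbelow : forall s, 0 <= s < T -> A (y s)).
  { intros s Hs. apply NNPP. intros Hs'. assert (T <= s); [|lra].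
    apply HT2. intros t [Ht1 Ht2]. destruct (Rle_dec t s); [assumption|].
    exfalso. apply Hs', Ht2. lra. }
  destruct (Hcov _ (HSy T HT)) as [HAT|HBT].
  - destruct (proj1 (locally_disc _ _) (HA _ HAT)) as [d [Hd Hsub]].
    destruct (line_near zA (zB - zA) T d Hd) as [eta [Heta Hn]].
    destruct (Req_dec T 1) as [->|HT3].
    { apply Hno. exists (y 1%R). split; [now apply HSy|]. split; [exact HAT|now rewrite Hy1]. }
    assert (HE : E (Rmin 1 (T + eta / 2))).
    { pose proof (Rmin_l 1 (T + eta / 2)). pose proof (Rmin_r 1 (T + eta / 2)).
      split.
      - split; [|lra]. apply Rmin_glb; lra.
      - intros s Hs. destruct (Rlt_dec s T); [apply Hbelow; lra|].
        apply Hsub, Hn. rewrite Rabs_pos_eq; lra. }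
    apply HT1 in HE. unfold Rmin in HE. destruct (Rle_dec 1 (T + eta / 2)); lra.
  - destruct (proj1 (locally_disc _ _) (HB _ HBT)) as [d [Hd Hsub]].
    destruct (line_near zA (zB - zA) T d Hd) as [eta [Heta Hn]].
    destruct (Req_dec T 0) as [->|HT3].
    { apply Hno. exists zA. rewrite Hy0 in HBT. auto. }
    set (s := Rmax 0 (T - eta / 2)).
    assert (Hs : 0 <= s < T /\ T - eta / 2 <= s).
    { unfold s. split; [split; [apply Rmax_l|]|apply Rmax_r]. apply Rmax_lub_lt; lra. }
    apply Hno. exists (y s). split; [apply HSy; lra|]. split; [apply Hbelow; lra|].
    apply Hsub, Hn. rewrite Rabs_left; lra.
Qed.

(** * The two charts *)

(* Chart A: (y, y').  Chart B: y = u^-2, y' = -2 u^-3 - x u / 2 - u^2 / 2 + u^3 v,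
   in which P1 becomes the polynomial system
     u' = 1 + w u^3,  v' = w (x / 2 + u - 3 u^2 v),  w = (x u + u^2) / 4 - u^3 v / 2;
   poles of y are the (simple) zeros of u. *)
Definition FA1 : pexp := PV.
Definition FA2 : pexp := PAdd (PMul (PConst 6) (PMul PU PU)) PX.

Definition FB0 : pexp :=
  PAdd (PAdd (PMul (PConst (1/4)) (PMul PX PU)) (PMul (PConst (1/4)) (PMul PU PU)))
    (PMul (PConst (-(1/2))) (PMul (PMul PU (PMul PU PU)) PV)).
Definition FB1 : pexp := PAdd (PConst 1) (PMul FB0 (PMul PU (PMul PU PU))).
Definition FB2 : pexp :=
  PMul FB0 (PAdd (PAdd (PMul (PConst (1/2)) PX) PU) (PMul (PConst (-(3))) (PMul (PMul PU PU) PV))).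

Definition chartB_dy (x u v : C) : C := -(2) * / u ^ 3 - (1/2) * (x * u) - (1/2) * u ^ 2 + u ^ 3 * v.

Notation sysA := (sys FA1 FA2).
Notation sysB := (sys FB1 FB2).

Lemma Cpow_2_3_neq_0 (u : C) : u <> 0 -> u ^ 2 <> 0 /\ u ^ 3 <> 0.
Proof. intros; split; now apply Cpow_nz. Qed.

Lemma sysB_sysA (u v : C -> C) (z : C) : sysB u v z -> u z <> 0 ->
  sysA (fun w => / u w ^ 2) (fun w => chartB_dy w (u w) (v w)) z.
Proof.
  intros [Hu Hv] Hz. destruct (Cpow_2_3_neq_0 _ Hz) as [Hz2 Hz3]. split.
  - eapply cder_val; [|apply (cder_inv (fun w => u w ^ 2)); [exact Hz2|apply cder_pow, Hu]].
    unfold chartB_dy. cbn [peval FA1 FA2 FB0 FB1 FB2 pred INR]. rewrite RtoC_plus. field. exact Hz.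
  - unfold chartB_dy. eapply cder_val.
    2:{ apply (cder_plus (fun w => -(2) * / u w ^ 3 - (1/2) * (w * u w) - (1/2) * u w ^ 2) (fun w => u w ^ 3 * v w)).
        - apply (cder_minus (fun w => -(2) * / u w ^ 3 - (1/2) * (w * u w)) (fun w => (1/2) * u w ^ 2)).
          + apply (cder_minus (fun w => -(2) * / u w ^ 3) (fun w => (1/2) * (w * u w))).
            * apply (cder_mult (fun _ => -(2))); [apply cder_const|].
              apply (cder_inv (fun w => u w ^ 3)); [exact Hz3|apply cder_pow, Hu].
            * apply (cder_mult (fun _ => 1/2)); [apply cder_const|].
              apply (cder_mult (fun w => w)); [apply cder_id|exact Hu].
          + apply (cder_mult (fun _ => 1/2)); [apply cder_const|apply cder_pow, Hu].
        - apply (cder_mult (fun w => u w ^ 3)); [apply cder_pow, Hu|exact Hv]. }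
    cbn [peval FA1 FA2 FB0 FB1 FB2 pred INR]. rewrite !RtoC_plus. field. exact Hz.
Qed.

(* Coquelicot's inverse satisfies / 0 = 0, so [f z = / u z ^ 2] in polar_at also
   normalises the value of f at its poles to 0. *)
Definition regular_at (f : C -> C) (p : C) : Prop :=
  exists d, 0 < d /\ forall z, disc p d z -> sysA f (C_derive f) z.

Definition polar_at (f : C -> C) (p : C) : Prop :=
  exists (d : R) (u v : C -> C), 0 < d /\ u p = 0 /\
    forall z, disc p d z -> sysB u v z /\ f z = / u z ^ 2.

Definition mero_sol_at (f : C -> C) (p : C) : Prop := regular_at f p \/ polar_at f p.

Definition eq_near (f g : C -> C) (p : C) : Prop :=
  exists d, 0 < d /\ forall z, disc p d z -> f z = g z.

Lemma cder_C_derive (f : C -> C) (z l : C) : cder f z l -> C_derive f z = l.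
Proof. intros H. now apply is_C_derive_unique, cder_is_derive. Qed.

Lemma eq_near_open (f g : C -> C) (p : C) : eq_near f g p ->
  exists d, 0 < d /\ forall z, disc p d z -> eq_near f g z.
Proof.
  intros [d [Hd H]]. exists d. split; [exact Hd|]. intros z Hz.
  destruct (disc_open p d z Hz) as [d' [Hd' H']]. exists d'. split; auto.
Qed.

Lemma eq_near_sym (f g : C -> C) (p : C) : eq_near f g p -> eq_near g f p.
Proof. intros [d [Hd H]]. exists d. split; [exact Hd|]. intros. symmetry. auto. Qed.

Lemma eq_near_at (f g : C -> C) (p : C) : eq_near f g p -> f p = g p.
Proof. intros [d [Hd H]]. apply H. now apply disc_center. Qed.

Lemma cder_eq_near (f g : C -> C) (p l : C) : eq_near f g p -> cder f p l -> cder g p l.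
Proof. intros [d [Hd H]]. now apply cder_ext_loc with d. Qed.

Lemma regular_at_intro (f u v : C -> C) (p : C) (d : R) : 0 < d ->
  (forall z, disc p d z -> sysA u v z /\ f z = u z) -> regular_at f p.
Proof.
  intros Hd H.
  assert (He : forall z, disc p d z -> eq_near u f z).
  { intros z Hz. destruct (disc_open p d z Hz) as [d' [Hd' H']]. exists d'. split; [exact Hd'|].
    intros w Hw. symmetry. now apply H, H'. }
  assert (Hder : forall z, disc p d z -> cder f z (v z)).
  { intros z Hz. apply (cder_eq_near u f); [now apply He|]. now apply H. }
  assert (Hv : forall z, disc p d z -> v z = C_derive f z).
  { intros z Hz. symmetry. now apply cder_C_derive, Hder. }
  exists d. split; [exact Hd|]. intros z Hz. destruct (H z Hz) as [[H1 H2] H3]. split.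
  - simpl. rewrite <- Hv by exact Hz. now apply Hder.
  - simpl in *. rewrite H3. apply (cder_eq_near v); [|exact H2].
    destruct (disc_open p d z Hz) as [d' [Hd' H']]. exists d'. split; auto.
Qed.

Lemma regular_at_open (f : C -> C) (p : C) : regular_at f p ->
  exists d, 0 < d /\ forall z, disc p d z -> regular_at f z.
Proof.
  intros [d [Hd H]]. exists d. split; [exact Hd|]. intros z Hz.
  destruct (disc_open p d z Hz) as [d' [Hd' H']]. exists d'. split; auto.
Qed.

Lemma regular_at_sys (f : C -> C) (p : C) : regular_at f p -> sysA f (C_derive f) p.
Proof. intros [d [Hd H]]. apply H. now apply disc_center. Qed.

Lemma regular_at_eq_near (f g : C -> C) (p : C) : eq_near f g p -> regular_at f p -> regular_at g p.
Proof.
  intros [d [Hd H]] [d' [Hd' H']]. apply (regular_at_intro g f (C_derive f) p (Rmin d d')).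
  - now apply Rmin_pos.
  - intros z Hz. unfold disc in *. pose proof (Rmin_l d d'). pose proof (Rmin_r d d').
    split; [apply H'|symmetry; apply H]; lra.
Qed.

Lemma mero_sol_at_eq_near (f g : C -> C) (p : C) : eq_near f g p -> mero_sol_at f p -> mero_sol_at g p.
Proof.
  intros H [HA|[d [u [v [Hd [Hu HB]]]]]]; [left; now apply regular_at_eq_near with f|right].
  destruct H as [d' [Hd' H']]. exists (Rmin d d'), u, v. split; [now apply Rmin_pos|].
  split; [exact Hu|]. intros z Hz. unfold disc in *.
  pose proof (Rmin_l d d'). pose proof (Rmin_r d d').
  rewrite <- H' by lra. apply HB. lra.
Qed.

Lemma ccont_neq_0 (f : C -> C) (p : C) : ccont f p -> f p <> 0 ->
  exists d, 0 < d /\ forall z, disc p d z -> f z <> 0.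
Proof.
  intros H Hp. destruct (H (Cmod (f p))) as [d [Hd Hb]]; [now apply Cmod_gt_0|].
  exists d. split; [exact Hd|]. intros z Hz E. specialize (Hb z Hz). rewrite E in Hb.
  replace (0 - f p) with (- f p) in Hb by ring. rewrite Cmod_opp in Hb. lra.
Qed.

Lemma chartB_regular (f u v : C -> C) (p : C) (d : R) : 0 < d ->
  (forall z, disc p d z -> sysB u v z /\ f z = / u z ^ 2) -> u p <> 0 -> regular_at f p.
Proof.
  intros Hd H Hp. destruct (H p (disc_center p d Hd)) as [[Hu _] _].
  destruct (ccont_neq_0 u p (cder_ccont _ _ _ Hu) Hp) as [d' [Hd' Hn]].
  apply (regular_at_intro f (fun w => / u w ^ 2) (fun w => chartB_dy w (u w) (v w)) p (Rmin d d')).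
  - now apply Rmin_pos.
  - intros z Hz. unfold disc in *. pose proof (Rmin_l d d'). pose proof (Rmin_r d d').
    destruct (H z ltac:(lra)). split; [|assumption]. apply sysB_sysA; [assumption|]. apply Hn; lra.
Qed.

Lemma chartB_mero_sol_at (f u v : C -> C) (p : C) (d : R) :
  (forall z, disc p d z -> sysB u v z /\ f z = / u z ^ 2) ->
  forall z, disc p d z -> mero_sol_at f z.
Proof.
  intros H z Hz. destruct (disc_open p d z Hz) as [d' [Hd' H']].
  destruct (classic (u z = 0)) as [E|E].
  - right. exists d', u, v. split; [exact Hd'|]. split; auto.
  - left. apply (chartB_regular f u v z d'); auto.
Qed.

Lemma sysB_at_zero (u v : C -> C) (p : C) : sysB u v p -> u p = 0 -> cder u p 1 /\ cder v p 0.
Proof.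
  intros [H1 H2] E. split.
  - eapply cder_val; [|exact H1]. rewrite E. simpl. ring.
  - eapply cder_val; [|exact H2]. rewrite E. simpl. ring.
Qed.

(** Since u' = 1 at [p], u(z) differs from z - p by at most a quarter of |z - p|. This isolates the
    zero of [u], and later it tells [u] from [-u], the other square root of 1/f. *)
Lemma polar_at_near (f : C -> C) (p : C) : polar_at f p ->
  exists (d : R) (u v : C -> C), 0 < d /\ u p = 0 /\
    (forall z, disc p d z -> sysB u v z /\ f z = / u z ^ 2) /\
    (forall z, disc p d z -> Cmod (u z - (z - p)) <= 1/4 * Cmod (z - p)) /\
    (forall z, disc p d z -> z <> p -> u z <> 0 /\ regular_at f z).
Proof.
  intros [d [u [v [Hd [Hu H]]]]].
  destruct (sysB_at_zero u v p (proj1 (H p (disc_center p d Hd))) Hu) as [Hu1 _].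
  destruct (Hu1 (1/4)%R ltac:(lra)) as [d' [Hd' Hb]].
  assert (HM : 0 < Rmin d d') by now apply Rmin_pos.
  pose proof (Rmin_l d d') as M1. pose proof (Rmin_r d d') as M2.
  assert (H4 : forall z, disc p (Rmin d d') z -> Cmod (u z - (z - p)) <= 1/4 * Cmod (z - p)).
  { intros z Hz. replace (u z - (z - p)) with (u z - u p - 1 * (z - p)) by (rewrite Hu; ring).
    apply Hb. unfold disc in *; lra. }
  exists (Rmin d d'), u, v. split; [exact HM|]. split; [exact Hu|]. split; [|split; [exact H4|]].
  - intros z Hz. apply H. unfold disc in *; lra.
  - intros z Hz Hzp.
    assert (Hn : u z <> 0).
    { intros E. specialize (H4 z Hz). rewrite E in H4.
      replace (0 - (z - p)) with (- (z - p)) in H4 by ring. rewrite Cmod_opp in H4.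
      assert (0 < Cmod (z - p)).
      { apply Cmod_gt_0. intros E'. apply Hzp. replace z with ((z - p) + p) by ring. rewrite E'. ring. }
      lra. }
    split; [exact Hn|].
    destruct (disc_open p (Rmin d d') z Hz) as [d2 [Hd2 H2]].
    apply (chartB_regular f u v z d2); auto.
    intros w Hw. apply H. apply H2 in Hw. unfold disc in *; lra.
Qed.

(** * Uniqueness of meromorphic solutions *)

Lemma Cminus_eq_0 (a b : C) : a - b = 0 -> a = b.
Proof. intros H. replace a with ((a - b) + b) by ring. rewrite H. ring. Qed.

Lemma Cmod_minus_pos (a b : C) : a <> b -> 0 < Cmod (a - b).
Proof. intros H. apply Cmod_gt_0. intros E. apply H. now apply Cminus_eq_0. Qed.

Lemma point_near (p : C) (d : R) : 0 < d -> exists q, disc p d q /\ q <> p.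
Proof.
  intros Hd. exists (p + (d / 2)%R). split.
  - unfold disc. replace (p + (d / 2)%R - p) with (RtoC (d / 2)) by ring.
    rewrite Cmod_R, Rabs_pos_eq; lra.
  - intros E. assert (E' : RtoC (d / 2) = 0).
    { replace (RtoC (d / 2)) with ((p + (d / 2)%R) - p) by ring. rewrite E. ring. }
    apply RtoC_inj in E'. lra.
Qed.

Lemma regular_segment_unique (f g : C -> C) (q z : C) :
  (forall t, 0 <= t <= 1 -> regular_at f (q + t * (z - q)) /\ regular_at g (q + t * (z - q))) ->
  eq_near f g q -> f z = g z /\ C_derive f z = C_derive g z.
Proof.
  intros H He. apply (ode_unique FA1 FA2 f (C_derive f) g (C_derive g) q z).
  - intros t Ht. now apply regular_at_sys, H.
  - intros t Ht. now apply regular_at_sys, H.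
  - now apply eq_near_at.
  - assert (Hq : regular_at f q).
    { replace q with (q + 0%R * (z - q)) by ring. apply H; lra. }
    destruct (regular_at_sys f q Hq) as [H1 _]. simpl in H1. symmetry.
    apply cder_C_derive. now apply (cder_eq_near f g).
Qed.

(* The segment from q towards p avoids p until its end, so uniqueness in chart A
   applies on it. *)
Lemma punctured_agreement (f g : C -> C) (p q : C) (d eps : R) : 0 < eps ->
  (forall z, disc p d z -> z <> p -> regular_at f z /\ regular_at g z) ->
  disc p d q -> eq_near f g q ->
  exists z, disc p eps z /\ disc p d z /\ z <> p /\ f z = g z /\ C_derive f z = C_derive g z.
Proof.
  intros Heps H Hq He.
  (* If the point of agreement is [p] itself, one close by replaces it: agreement near a point is an
     open condition. *)
  assert (Hq' : exists q', disc p d q' /\ q' <> p /\ eq_near f g q').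
  { destruct (classic (q = p)) as [E|E]; [|exists q; auto].
    destruct (eq_near_open f g q He) as [d1 [Hd1 H1]].
    destruct (disc_open p d q Hq) as [d2 [Hd2 H2]].
    destruct (point_near p (Rmin d1 d2)) as [q' [H3 H4]]; [now apply Rmin_pos|].
    pose proof (Rmin_l d1 d2). pose proof (Rmin_r d1 d2). rewrite E in H1, H2.
    exists q'. split; [|split; [exact H4|]].
    - apply H2. unfold disc in *; lra.
    - apply H1. unfold disc in *; lra. }
  clear q Hq He. destruct Hq' as [q [Hq [Hqp He]]].
  pose proof (Cmod_minus_pos q p Hqp) as Hm.
  set (m := Cmod (q - p)) in *.
  set (s := Rmin 1 (eps / (2 * m))).
  assert (Hs : 0 < s <= 1).
  { split; [apply Rmin_pos; [lra|apply Rdiv_lt_0_compat; lra]|apply Rmin_l]. }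
  assert (Hsm : s * m < eps).
  { apply Rle_lt_trans with (eps / (2 * m) * m)%R.
    - apply Rmult_le_compat_r; [lra|apply Rmin_r].
    - replace (eps / (2 * m) * m)%R with (eps / 2)%R by (field; lra). lra. }
  set (z := q + (1 - s)%R * (p - q)).
  assert (Hseg : forall t, 0 <= t <= 1 ->
    disc p d (q + t * (z - q)) /\ q + t * (z - q) <> p).
  { intros t Ht.
    assert (E1 : q + t * (z - q) = q + (t * (1 - s))%R * (p - q)) by (unfold z; rewrite RtoC_mult; ring).
    split.
    - rewrite E1. apply convex_disc; [exact Hq|apply disc_center; unfold disc, m in *; lra|]. nra.
    - rewrite E1. intros E.
      assert (E2 : RtoC (1 - t * (1 - s)) * (q - p) = 0).
      { rewrite RtoC_minus.
        replace ((1 - (t * (1 - s))%R) * (q - p)) with (q + (t * (1 - s))%R * (p - q) - p) by ring.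
        rewrite E. ring. }
      apply (f_equal Cmod) in E2. rewrite Cmod_mult, Cmod_R, Cmod_0 in E2. fold m in E2.
      assert (Hts : 0 < 1 - t * (1 - s)) by nra.
      rewrite Rabs_pos_eq in E2 by lra.
      apply Rmult_integral in E2. lra. }
  assert (Hz1 : z = q + 1%R * (z - q)) by ring.
  destruct (Hseg 1%R ltac:(lra)) as [Hz2 Hz3]. rewrite <- Hz1 in Hz2, Hz3.
  destruct (regular_segment_unique f g q z) as [E1 E2]; [|exact He|].
  - intros t Ht. apply H; now apply Hseg.
  - exists z. repeat split; auto. unfold disc.
    replace (z - p) with (RtoC s * (q - p)) by (unfold z; rewrite RtoC_minus; ring).
    rewrite Cmod_mult, Cmod_R, Rabs_pos_eq by lra. exact Hsm.
Qed.

(** Agreement near some [q] would propagate to points arbitrarily close to [p], where [f] is bounded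
    and [g] is not. *)
Lemma regular_not_polar (f g : C -> C) (p : C) : regular_at f p -> polar_at g p ->
  exists d, 0 < d /\ forall q, disc p d q -> ~ eq_near f g q.
Proof.
  intros HA HB. destruct (regular_at_open f p HA) as [d1 [Hd1 HA1]].
  destruct (regular_at_sys f p HA) as [Hc _].
  destruct (cder_ccont _ _ _ Hc 1%R Rlt_0_1) as [d2 [Hd2 Hc2]].
  destruct (polar_at_near g p HB) as [d3 [u [v [Hd3 [Hu [HB1 [HB2 HB3]]]]]]].
  set (d := Rmin d1 (Rmin d2 d3)).
  assert (Hd : 0 < d) by (repeat apply Rmin_pos; lra).
  assert (d <= d1 /\ d <= d2 /\ d <= d3) as [M1 [M2 M3]].
  { unfold d. pose proof (Rmin_l d1 (Rmin d2 d3)). pose proof (Rmin_r d1 (Rmin d2 d3)).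
    pose proof (Rmin_l d2 d3). pose proof (Rmin_r d2 d3). repeat split; lra. }
  exists d. split; [exact Hd|]. intros q Hq He.
  set (M := (Cmod (f p) + 1)%R). pose proof (Cmod_ge_0 (f p)).
  (* Here M >= 1 bounds |f|. At the point obtained |u| <= 5/4 |z - p| < 1/M, hence M |u|^2 < 1,
     against |u|^-2 = |g| < M. *)
  destruct (punctured_agreement f g p q d (/ (2 * M))) as [z [Hz1 [Hz2 [Hz3 [Hz4 _]]]]].
  - apply Rinv_0_lt_compat. unfold M; lra.
  - intros z Hz Hzp. split; [apply HA1|apply HB3]; auto; unfold disc in *; lra.
  - exact Hq.
  - exact He.
  - assert (Hz5 : disc p d2 z) by (unfold disc in *; lra).
    assert (Hz6 : disc p d3 z) by (unfold disc in *; lra).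
    destruct (HB1 z Hz6) as [_ Eg]. destruct (HB3 z Hz6 Hz3) as [Hn _].
    assert (Hfz : Cmod (f z) < M).
    { specialize (Hc2 z Hz5). pose proof (Cmod_triangle (f z - f p) (f p)).
      replace (f z - f p + f p) with (f z) in H0 by ring. unfold M. lra. }
    rewrite Hz4, Eg, Cmod_inv, Cmod_pow in Hfz by now apply Cpow_2_3_neq_0.
    pose proof (HB2 z Hz6) as Hu2.
    pose proof (Cmod_triangle (u z - (z - p)) (z - p)) as T.
    replace (u z - (z - p) + (z - p)) with (u z) in T by ring.
    unfold disc in Hz1. assert (Hup : 0 < Cmod (u z)) by now apply Cmod_gt_0.
    set (k := Cmod (u z)) in *.
    assert (HM : 1 <= M) by (unfold M; lra).
    assert (Hk : k < / M).
    { replace (/ (2 * M))%R with (/ 2 * / M)%R in Hz1 by (field; lra).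
      pose proof (Rinv_0_lt_compat M ltac:(lra)). lra. }
    assert (HkM : k * M < 1).
    { apply Rlt_le_trans with (/ M * M)%R; [apply Rmult_lt_compat_r; lra|right; field; lra]. }
    assert (M * k ^ 2 < 1) by nra.
    assert (1 < M * k ^ 2); [|lra].
    replace 1%R with (/ k ^ 2 * k ^ 2)%R by (field; lra).
    apply Rmult_lt_compat_r; [apply pow_lt; lra|exact Hfz].
Qed.

(** At some common regular point near [p] the values and derivatives agree. The values give u1 = u2
    or u1 = -u2, closeness of both to z - p excludes the latter, and the derivatives then give v1 =
    v2. Uniqueness in chart B, for which [p] is an ordinary point, reaches the whole disc. *)
Lemma polar_polar_unique (f g : C -> C) (p : C) : polar_at f p -> polar_at g p ->
  exists d, 0 < d /\ forall q, disc p d q -> eq_near f g q -> forall z, disc p d z -> f z = g z.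
Proof.
  intros Hf Hg.
  destruct (polar_at_near f p Hf) as [d1 [u1 [v1 [Hd1 [Hu1 [A1 [A2 A3]]]]]]].
  destruct (polar_at_near g p Hg) as [d2 [u2 [v2 [Hd2 [Hu2 [B1 [B2 B3]]]]]]].
  exists (Rmin d1 d2). split; [now apply Rmin_pos|]. intros q Hq He w Hw.
  pose proof (Rmin_l d1 d2) as M1. pose proof (Rmin_r d1 d2) as M2.
  destruct (punctured_agreement f g p q (Rmin d1 d2) 1) as [z [_ [Hz2 [Hz3 [E1 E2]]]]]; auto.
  - lra.
  - intros z Hz Hzp. split; [apply A3|apply B3]; auto; unfold disc in *; lra.
  - assert (Hz4 : disc p d1 z) by (unfold disc in *; lra).
    assert (Hz5 : disc p d2 z) by (unfold disc in *; lra).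
    destruct (A1 z Hz4) as [SA EA]. destruct (B1 z Hz5) as [SB EB].
    destruct (A3 z Hz4 Hz3) as [NA _]. destruct (B3 z Hz5 Hz3) as [NB _].
    assert (D1 : C_derive f z = chartB_dy z (u1 z) (v1 z)).
    { apply cder_C_derive. apply (cder_eq_near (fun w => / u1 w ^ 2)).
      - destruct (disc_open p d1 z Hz4) as [d' [Hd' H']]. exists d'. split; [exact Hd'|].
        intros s Hs. symmetry. now apply A1, H'.
      - now apply sysB_sysA. }
    assert (D2 : C_derive g z = chartB_dy z (u2 z) (v2 z)).
    { apply cder_C_derive. apply (cder_eq_near (fun w => / u2 w ^ 2)).
      - destruct (disc_open p d2 z Hz5) as [d' [Hd' H']]. exists d'. split; [exact Hd'|].
        intros s Hs. symmetry. now apply B1, H'.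
      - now apply sysB_sysA. }
    rewrite EA, EB in E1. rewrite D1, D2 in E2.
    assert (Esq : (u1 z - u2 z) * (u1 z + u2 z) = 0).
    { replace ((u1 z - u2 z) * (u1 z + u2 z)) with ((/ u2 z ^ 2 - / u1 z ^ 2) * (u1 z ^ 2 * u2 z ^ 2))
        by (field; auto). rewrite E1. ring. }
    assert (Eu : u1 z = u2 z).
    { apply Cminus_eq_0. apply NNPP. intros N1.
      assert (N2 : u1 z + u2 z = 0).
      { apply NNPP. intros N2. now apply (Cmult_neq_0 _ _ N1 N2). }
      pose proof (A2 z Hz4) as U1. pose proof (B2 z Hz5) as U2.
      pose proof (Cmod_triangle (u1 z - (z - p)) (u2 z - (z - p))) as T.
      replace (u1 z - (z - p) + (u2 z - (z - p))) with (- (RtoC 2 * (z - p)) + (u1 z + u2 z)) in T by ring.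
      rewrite N2, Cplus_0_r, Cmod_opp, Cmod_mult, Cmod_R, Rabs_pos_eq in T by lra.
      pose proof (Cmod_minus_pos z p Hz3). lra. }
    assert (Ev : v1 z = v2 z).
    { unfold chartB_dy in E2. rewrite <- Eu in E2. apply Cminus_eq_0.
      replace (v1 z - v2 z) with (/ u1 z ^ 3 * ((-(2) * / u1 z ^ 3 - 1 / 2 * (z * u1 z) - 1 / 2 * u1 z ^ 2 + u1 z ^ 3 * v1 z) -
        (-(2) * / u1 z ^ 3 - 1 / 2 * (z * u1 z) - 1 / 2 * u1 z ^ 2 + u1 z ^ 3 * v2 z))) by (field; auto).
      rewrite E2. ring. }
    destruct (ode_unique FB1 FB2 u1 v1 u2 v2 z w) as [E _]; auto.
    + intros t Ht. apply A1.
      assert (disc p (Rmin d1 d2) (z + t * (w - z))) by now apply convex_disc. unfold disc in *; lra.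
    + intros t Ht. apply B1.
      assert (disc p (Rmin d1 d2) (z + t * (w - z))) by now apply convex_disc. unfold disc in *; lra.
    + destruct (A1 w) as [_ ->]; [unfold disc in *; lra|].
      destruct (B1 w) as [_ ->]; [unfold disc in *; lra|]. now rewrite E.
Qed.

(** The disc is chosen before [q], so agreement near any of its points spreads to its centre. Hence
    the points without agreement form an open set, as the connectedness argument below requires. *)
Lemma mero_sol_at_local_unique (f g : C -> C) (p : C) : mero_sol_at f p -> mero_sol_at g p ->
  exists d, 0 < d /\ forall q, disc p d q -> eq_near f g q -> forall z, disc p d z -> f z = g z.
Proof.
  intros [Hf|Hf] [Hg|Hg].
  - destruct (regular_at_open f p Hf) as [d1 [Hd1 H1]]. destruct (regular_at_open g p Hg) as [d2 [Hd2 H2]].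
    exists (Rmin d1 d2). split; [now apply Rmin_pos|]. intros q Hq He z Hz.
    pose proof (Rmin_l d1 d2). pose proof (Rmin_r d1 d2).
    apply (regular_segment_unique f g q z); [|exact He]. intros t Ht.
    assert (disc p (Rmin d1 d2) (q + t * (z - q))) by now apply convex_disc.
    split; [apply H1|apply H2]; unfold disc in *; lra.
  - destruct (regular_not_polar f g p Hf Hg) as [d [Hd H]]. exists d. split; [exact Hd|].
    intros q Hq He. now destruct (H q Hq).
  - destruct (regular_not_polar g f p Hg Hf) as [d [Hd H]]. exists d. split; [exact Hd|].
    intros q Hq He. destruct (H q Hq). now apply eq_near_sym.
  - now apply polar_polar_unique.
Qed.

(** An identity theorem without power series: the points of [U] near which [f] and [g] agree and the
    remaining ones both form open sets, and connectedness leaves the second empty. *)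
Lemma mero_sol_at_unique (U : C -> Prop) (f g : C -> C) (a : C) :
  C_open U -> C_connected U -> (forall p, U p -> mero_sol_at f p) -> (forall p, U p -> mero_sol_at g p) ->
  U a -> eq_near f g a -> forall z, U z -> f z = g z.
Proof.
  intros HU Hc Hf Hg Ha He z Hz. apply NNPP. intros Hne.
  destruct (Hc (fun p => U p /\ eq_near f g p) (fun p => U p /\ ~ eq_near f g p)) as [w [_ [[_ H1] [_ H2]]]].
  - intros p [Hp Hep]. apply locally_disc.
    destruct (proj1 (locally_disc _ _) (HU p Hp)) as [d1 [Hd1 H1]].
    destruct (eq_near_open f g p Hep) as [d2 [Hd2 H2]].
    exists (Rmin d1 d2). split; [now apply Rmin_pos|]. intros w Hw.
    pose proof (Rmin_l d1 d2). pose proof (Rmin_r d1 d2).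
    split; [apply H1|apply H2]; unfold disc in *; lra.
  - intros p [Hp Hep]. apply locally_disc.
    destruct (proj1 (locally_disc _ _) (HU p Hp)) as [d1 [Hd1 H1]].
    destruct (mero_sol_at_local_unique f g p (Hf p Hp) (Hg p Hp)) as [d2 [Hd2 H2]].
    exists (Rmin d1 d2). split; [now apply Rmin_pos|]. intros w Hw.
    pose proof (Rmin_l d1 d2). pose proof (Rmin_r d1 d2).
    split; [apply H1; unfold disc in *; lra|]. intros Hew. apply Hep.
    exists d2. split; [exact Hd2|]. apply (H2 w); [unfold disc in *; lra|exact Hew].
  - intros w Hw. destruct (classic (eq_near f g w)); auto.
  - now exists a.
  - exists z. repeat split; auto. intros H. apply Hne. now apply eq_near_at.
  - contradiction.
Qed.

(** * Products and conjugates along a real parameter *)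

Lemma rder_val (g : R -> C) (t : R) (l m : C) : l = m -> rder g t l -> rder g t m.
Proof. now intros ->. Qed.

Lemma rder_plus (g h : R -> C) (t : R) (l m : C) :
  rder g t l -> rder h t m -> rder (fun s => g s + h s) t (l + m).
Proof.
  intros [H1 H2] [H3 H4]. split.
  - exact (is_derive_plus (V := R_NormedModule) _ _ _ _ _ H1 H3).
  - exact (is_derive_plus (V := R_NormedModule) _ _ _ _ _ H2 H4).
Qed.

Lemma rder_const (c : C) (t : R) : rder (fun _ => c) t 0.
Proof. split; exact (is_derive_const (V := R_NormedModule) _ t). Qed.

Lemma is_derive_mult_R (h k : R -> R) (t a b : R) :
  is_derive h t a -> is_derive k t b -> is_derive (fun s => h s * k s)%R t (a * k t + h t * b)%R.
Proof. intros H1 H2. exact (is_derive_mult h k t a b H1 H2 Rmult_comm). Qed.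

Lemma rder_mult (g h : R -> C) (t : R) (l m : C) :
  rder g t l -> rder h t m -> rder (fun s => g s * h s) t (l * h t + g t * m).
Proof.
  intros [H1 H2] [H3 H4]. split.
  - replace (Re (l * h t + g t * m)) with
      ((Re l * Re (h t) + Re (g t) * Re m) - (Im l * Im (h t) + Im (g t) * Im m))%R
      by (unfold Re, Im; simpl; ring).
    exact (is_derive_minus (V := R_NormedModule) _ _ _ _ _
      (is_derive_mult_R _ _ _ _ _ H1 H3) (is_derive_mult_R _ _ _ _ _ H2 H4)).
  - replace (Im (l * h t + g t * m)) with
      ((Re l * Im (h t) + Re (g t) * Im m) + (Im l * Re (h t) + Im (g t) * Re m))%R
      by (unfold Re, Im; simpl; ring).
    exact (is_derive_plus (V := R_NormedModule) _ _ _ _ _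
      (is_derive_mult_R _ _ _ _ _ H1 H4) (is_derive_mult_R _ _ _ _ _ H2 H3)).
Qed.

Lemma rder_conj (g : R -> C) (t : R) (l : C) :
  rder g t l -> rder (fun s => Cconj (g s)) t (Cconj l).
Proof.
  intros [H1 H2]. split.
  - exact H1.
  - exact (is_derive_opp (V := R_NormedModule) _ _ _ H2).
Qed.

(** * The energy *)

(* phi is a smooth replacement for 1/y, bounded at y = 0; it makes |dV/dt| <= C (1 + |V|)
   hold for all values of y, V being the energy below. *)
Definition phi (y : C) : C := Cconj y / (1 + y * Cconj y).

Definition energy (x y q : C) : C := q ^ 2 - 4 * y ^ 3 - 2 * (x * y) + q * phi y.

Lemma one_plus_conj (y : C) : 1 + y * Cconj y = RtoC (1 + Cmod y ^ 2).
Proof. now rewrite RtoC_plus, Cmod2_conj. Qed.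

Lemma one_plus_conj_neq_0 (y : C) : 1 + y * Cconj y <> 0.
Proof.
  rewrite one_plus_conj. intros E. apply RtoC_inj in E. pose proof (Cmod_ge_0 y). nra.
Qed.

Lemma rder_inv_real (h : R -> R) (t a : R) : h t <> 0%R -> is_derive h t a ->
  rder (fun s => / RtoC (h s)) t (RtoC (- a / h t ^ 2)).
Proof.
  intros Hn H. pose proof (is_derive_inv h t a H Hn) as D. split.
  - apply (is_derive_ext (fun s => / h s)%R); [|exact D].
    (* Both inverses send 0 to 0, so the two functions coincide everywhere and not only near [t]. *)
    intros s. destruct (Req_dec (h s) 0) as [E|E].
    + rewrite E, Rinv_0. unfold Re. simpl. unfold Rdiv. ring.
    + now rewrite <- RtoC_inv.
  - apply (is_derive_ext (fun _ => 0%R)); [|exact (is_derive_const (V := R_NormedModule) _ t)].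
    intros s. unfold Im. simpl. unfold Rdiv. ring.
Qed.

Lemma rder_phi (y : R -> C) (t : R) (l : C) : rder y t l ->
  rder (fun s => phi (y s)) t
    (Cconj l * / (1 + y t * Cconj (y t))
     - Cconj (y t) * ((l * Cconj (y t) + y t * Cconj l) / (1 + y t * Cconj (y t)) ^ 2)).
Proof.
  intros H. unfold phi.
  pose proof (is_derive_plus (V := R_NormedModule) (fun _ => 1%R) _ t 0%R _
    (is_derive_const (V := R_NormedModule) _ t) (rder_Cmod2 y t l H)) as D.
  assert (Hn : (1 + Cmod (y t) ^ 2)%R <> 0%R) by (pose proof (Cmod_ge_0 (y t)); nra).
  pose proof (rder_mult _ _ _ _ _ (rder_conj _ _ _ H) (rder_inv_real _ t _ Hn D)) as D2.
  eapply rder_val; [|].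
  2:{ destruct D2 as [D3 D4]. split; (eapply is_derive_ext; [|eassumption]); intros s; cbv beta;
      rewrite one_plus_conj; reflexivity. }
  cbv beta. rewrite !one_plus_conj.
  assert (E : RtoC (2 * (Re (y t) * Re l + Im (y t) * Im l)) = l * Cconj (y t) + y t * Cconj l).
  { destruct (y t) as [a b], l as [c d]. unfold RtoC, Cconj, Cmult, Cplus, Re, Im. simpl. f_equal; ring. }
  rewrite <- E. change plus with Rplus. change zero with 0%R.
  rewrite Rplus_0_l. rewrite RtoC_div by (apply pow_nonzero; exact Hn).
  rewrite RtoC_opp, RtoC_pow.
  assert (Hn' : RtoC (1 + Cmod (y t) ^ 2) <> 0) by (intros E'; apply RtoC_inj in E'; contradiction).
  field. exact Hn'.
Qed.

(* The term in (y')^2 coming from phi' is eliminated with the definition of the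
   energy; with s = y conj(y) k = 1 - k the cubic growth cancels through
   -2 + 6 s - 4 s^2 = -2 (1 - s) (1 - 2 s). *)
Lemma rder_energy (f q : C -> C) (p e : C) (t : R) : sysA f q (p + t * e) ->
  let x := p + t * e in let y := f x in let k := / (1 + y * Cconj y) in
  rder (fun s : R => energy (p + s * e) (f (p + s * e)) (q (p + s * e))) t
    (e * (- (2) * (y * (k * (2 * k - 1))) + x * (phi y * (2 * k - 1)) - phi y ^ 2 * energy x y (q x) + q x * phi y ^ 3)
     + q x * Cconj (q x) * Cconj e * k ^ 2).
Proof.
  intros [H1 H2] x y k.
  pose proof (cder_rder _ _ _ _ _ (cder_id (p + t * e))) as Dx.
  pose proof (cder_rder _ _ _ _ _ H1) as Dy. pose proof (cder_rder _ _ _ _ _ H2) as Dq.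
  pose proof (rder_phi _ _ _ Dy) as Dp.
  fold x in Dx, Dy, Dq, Dp. simpl peval in Dy, Dq, Dp.
  unfold energy.
  eapply rder_val.
  2:{ apply (rder_plus (fun s : R => q (p + s * e) ^ 2 - 4 * f (p + s * e) ^ 3 - 2 * ((p + s * e) * f (p + s * e)))).
      2:{ apply rder_mult; [exact Dq|exact Dp]. }
      apply (rder_minus (fun s : R => q (p + s * e) ^ 2 - 4 * f (p + s * e) ^ 3)).
      2:{ apply (rder_mult (fun _ => RtoC 2)); [apply rder_const|]. apply rder_mult; [exact Dx|exact Dy]. }
      apply (rder_minus (fun s : R => q (p + s * e) ^ 2)).
      2:{ apply (rder_mult (fun _ => RtoC 4)); [apply rder_const|].
          apply (rder_mult _ (fun s : R => f (p + s * e) ^ 2)); [exact Dy|].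
          apply (rder_mult _ (fun s : R => f (p + s * e) ^ 1)); [exact Dy|].
          apply (rder_mult _ (fun s : R => RtoC 1)); [exact Dy|apply rder_const]. }
      apply (rder_mult _ (fun s : R => q (p + s * e) ^ 1)); [exact Dq|].
      apply (rder_mult _ (fun s : R => RtoC 1)); [exact Dq|apply rder_const]. }
  cbv beta. change (p + t * e) with x. change (f x) with y. unfold phi, k. rewrite Cmult_conj. clear k.
  (* The conjugate of y becomes an indeterminate Y with 1 + y Y nonzero; what remains is an identity
     of rational functions. *)
  generalize (one_plus_conj_neq_0 y). generalize (Cconj y). intros Y Hn.
  cbn [Cpow]. field. exact Hn.
Qed.

Lemma Rmult_le_self (a b : R) : 0 <= a -> b <= 1 -> a * b <= a.
Proof. nra. Qed.

(** Here m = |y|, n = |y'| and W = |V|. The key quantity is N = n k: multiplying the bound on n^2 by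
    k^2 tames its cubic term, because m^3 k^2 <= 1/2, so N^2 grows at most linearly in W. The factor
    20 + 10 R is a generous total. *)
Lemma energy_rate_bound (m n k R W : R) : 0 <= m -> 0 <= n -> 0 <= R -> 0 <= W ->
  k = (/ (1 + m ^ 2))%R -> n ^ 2 <= W + 4 * m ^ 3 + 2 * R * m + n * (m * k) ->
  2 * (m * k) + R * (m * k) + (m * k) ^ 2 * W + n * (m * k) ^ 3 + n ^ 2 * k ^ 2 <= (20 + 10 * R) * (1 + W).
Proof.
  intros Hm Hn HR HW Hk H.
  assert (Hk1 : (k * (1 + m ^ 2) = 1)%R) by (rewrite Hk; field; nra).
  assert (Hk0 : 0 < k) by (rewrite Hk; apply Rinv_0_lt_compat; nra).
  assert (Hk2 : k <= 1) by nra.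
  assert (Hmk : m * k <= 1/2).
  { apply Rmult_le_reg_r with (1 + m ^ 2)%R; [nra|]. rewrite Rmult_assoc, Hk1.
    pose proof (pow2_ge_0 (m - 1)). lra. }
  assert (Hmk0 : 0 <= m * k) by nra.
  assert (Hm2 : m ^ 2 * k <= 1) by nra.
  assert (Hm20 : 0 <= m ^ 2 * k) by (apply Rmult_le_pos; nra).
  assert (Hm3 : m ^ 3 * k ^ 2 <= 1/2).
  { replace (m ^ 3 * k ^ 2)%R with ((m * k) * (m ^ 2 * k))%R by ring. nra. }
  set (N := (n * k)%R). assert (HN0 : 0 <= N) by (unfold N; nra).
  assert (HN : N ^ 2 <= W + 2 + R + N / 2).
  { replace (N ^ 2)%R with (n ^ 2 * k ^ 2)%R by (unfold N; ring).
    apply Rle_trans with ((W + 4 * m ^ 3 + 2 * R * m + n * (m * k)) * k ^ 2)%R.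
    { apply Rmult_le_compat_r; nra. }
    replace ((W + 4 * m ^ 3 + 2 * R * m + n * (m * k)) * k ^ 2)%R
      with (W * k ^ 2 + 4 * (m ^ 3 * k ^ 2) + 2 * R * (m * k) * k + N * ((m * k) * k))%R by (unfold N; ring).
    assert (Hk3 : k ^ 2 <= 1) by nra.
    assert (W * k ^ 2 <= W) by now apply Rmult_le_self.
    assert (m * k * k <= m * k) by (apply Rmult_le_self; lra).
    assert (R * (m * k * k) <= R * (1/2)) by (apply Rmult_le_compat_l; lra).
    assert (N * (m * k * k) <= N / 2) by nra. lra. }
  replace (n ^ 2 * k ^ 2)%R with (N ^ 2)%R by (unfold N; ring).
  assert (H1 : n * (m * k) ^ 3 <= N).
  { replace (n * (m * k) ^ 3)%R with (N * (m ^ 3 * k ^ 2))%R by (unfold N; ring). nra. }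
  assert (H2 : W * (m * k) ^ 2 <= W) by (apply Rmult_le_self; nra).
  assert (H3 : R * (m * k) <= R) by (apply Rmult_le_self; lra).
  assert (H4 : N ^ 2 <= 2 * (W + 2 + R) + 1/4) by nra.
  assert (H5 : N <= 1 + N ^ 2) by nra.
  nra.
Qed.

Lemma Cmod_phi (y : C) : Cmod (phi y) = (Cmod y * / (1 + Cmod y ^ 2))%R.
Proof.
  unfold phi. rewrite Cmod_div by apply one_plus_conj_neq_0.
  rewrite one_plus_conj, Cmod_conj, Cmod_R, Rabs_pos_eq; [reflexivity|].
  pose proof (Cmod_ge_0 y). nra.
Qed.

Lemma Cmod_triangle4 (a b c d : C) : Cmod (a + b - c + d) <= Cmod a + Cmod b + Cmod c + Cmod d.
Proof.
  eapply Rle_trans; [apply Cmod_triangle|]. apply Rplus_le_compat_r.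
  eapply Rle_trans; [apply Cmod_triangle_minus|]. apply Rplus_le_compat_r. apply Cmod_triangle.
Qed.

Lemma momentum_bound (x y q : C) (R : R) : Cmod x <= R ->
  Cmod q ^ 2 <= Cmod (energy x y q) + 4 * Cmod y ^ 3 + 2 * R * Cmod y + Cmod q * (Cmod y * / (1 + Cmod y ^ 2)).
Proof.
  intros Hx. rewrite <- Cmod_phi, <- Cmod_pow, <- Cmod_mult.
  replace (q ^ 2) with (energy x y q + 4 * y ^ 3 - q * phi y + 2 * (x * y)) by (unfold energy; ring).
  eapply Rle_trans; [apply Cmod_triangle4|].
  rewrite (Cmod_mult 4), (Cmod_mult 2), !Cmod_R, !Rabs_pos_eq by lra.
  rewrite Cmod_pow, (Cmod_mult x). pose proof (Cmod_ge_0 y).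
  assert (Cmod x * Cmod y <= R * Cmod y) by (apply Rmult_le_compat_r; lra). lra.
Qed.

Lemma energy_rate (x y q e : C) (R : R) : Cmod x <= R ->
  let k := / (1 + y * Cconj y) in
  Cmod (e * (- (2) * (y * (k * (2 * k - 1))) + x * (phi y * (2 * k - 1)) - phi y ^ 2 * energy x y q + q * phi y ^ 3)
     + q * Cconj q * Cconj e * k ^ 2)
  <= Cmod e * ((20 + 10 * R) * (1 + Cmod (energy x y q))).
Proof.
  intros Hx k. pose proof (Cmod_ge_0 y) as Hy. pose proof (Cmod_ge_0 q) as Hq.
  pose proof (Cmod_ge_0 x) as Hx0. pose proof (Cmod_ge_0 (energy x y q)) as HW.
  set (kr := (/ (1 + Cmod y ^ 2))%R).
  assert (Hk : k = RtoC kr).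
  { unfold k, kr. rewrite one_plus_conj, RtoC_inv; [reflexivity|nra]. }
  assert (Hkr : 0 < kr <= 1).
  { unfold kr. split; [apply Rinv_0_lt_compat; nra|].
    rewrite <- Rinv_1 at 2. apply Rinv_le_contravar; nra. }
  assert (H2k : Cmod (2 * k - 1) <= 1).
  { rewrite Hk, <- RtoC_mult, <- RtoC_minus, Cmod_R. apply Rabs_le. lra. }
  assert (Hkm : Cmod k = kr) by (rewrite Hk, Cmod_R, Rabs_pos_eq; lra).
  pose proof (energy_rate_bound (Cmod y) (Cmod q) kr R (Cmod (energy x y q)) Hy Hq ltac:(lra) HW eq_refl
    (momentum_bound x y q R Hx)) as B.
  eapply Rle_trans; [apply Cmod_triangle|]. rewrite !(Cmod_mult e), !(Cmod_mult _ (k ^ 2)), !(Cmod_mult _ (Cconj e)), !(Cmod_mult q), !Cmod_conj.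
  rewrite (Cmod_pow k), Hkm.
  replace (Cmod q * Cmod q * Cmod e * kr ^ 2)%R with (Cmod e * (Cmod q ^ 2 * kr ^ 2))%R by ring.
  rewrite <- Rmult_plus_distr_l. apply Rmult_le_compat_l; [apply Cmod_ge_0|].
  eapply Rle_trans; [|exact B]. apply Rplus_le_compat_r.
  eapply Rle_trans; [apply Cmod_triangle4|].
  rewrite !Cmod_mult, !Cmod_pow, Cmod_phi, Cmod_opp, Cmod_R, Rabs_pos_eq, Hkm by lra. fold kr.
  set (m := Cmod y) in *. set (n := Cmod q) in *. set (c := Cmod (2 * k - 1)) in *.
  assert (0 <= c) by apply Cmod_ge_0.
  assert (0 <= m * kr) by nra.
  assert (m * (kr * c) <= m * kr) by nra.
  assert (Cmod x * (m * kr * c) <= R * (m * kr)) by (apply Rmult_le_compat; nra).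
  lra.
Qed.

Lemma Cconj_neq_0 (u : C) : u <> 0 -> Cconj u <> 0.
Proof. intros H. apply Cmod_gt_0. rewrite Cmod_conj. now apply Cmod_gt_0. Qed.

(** Here y' = -2 u^-3 - b. Of the polar parts of y'^2, 4 y^3 and 2 x y only 2/u survives, and y'
    phi(y), with phi(u^-2) = u^2 k, contributes -2 k/u. As 1 - k = |u|^4 k, their sum 2 (1 - k)/u is
    the last term on the right. *)
Lemma energy_chartB (x u v : C) : u <> 0 ->
  let b := (1/2) * (x * u) + (1/2) * u ^ 2 - u ^ 3 * v in
  let k := / RtoC (1 + Cmod u ^ 4) in
  energy x (/ u ^ 2) (chartB_dy x u v) + 4 * v = b ^ 2 - b * (u ^ 2 * k) + 2 * (Cconj u * (u * Cconj u) * k).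
Proof.
  intros Hu b k.
  assert (Ek : RtoC (1 + Cmod u ^ 4) = 1 + (u * Cconj u) ^ 2).
  { rewrite RtoC_plus, <- Cmod2_conj, <- RtoC_pow. do 2 f_equal. ring. }
  assert (Hk : RtoC (1 + Cmod u ^ 4) <> 0).
  { intros E. apply RtoC_inj in E. pose proof (pow_le (Cmod u) 4 (Cmod_ge_0 u)). lra. }
  unfold k, b. rewrite Ek in *. unfold energy, phi, chartB_dy.
  destruct (Cpow_2_3_neq_0 u Hu) as [Hu2 _].
  rewrite Cinv_conj, Cpow_conj by exact Hu2.
  pose proof (Cconj_neq_0 u Hu) as HU. clear Ek b k Hu2. generalize dependent (Cconj u). intros U Hk HU.
  field. repeat split; auto.
Qed.

(** The bound is quadratic in |u|, hence in the distance to the pole, so V + 4 v contributes nothing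
    to the derivative of the energy there. *)
Lemma energy_near_pole (x u v : C) (R M : R) : Cmod x <= R -> Cmod v <= M -> u <> 0 -> Cmod u <= 1 ->
  Cmod (energy x (/ u ^ 2) (chartB_dy x u v) + 4 * v) <= ((R + 1 + M) ^ 2 + (R + 1 + M) + 2) * Cmod u ^ 2.
Proof.
  intros Hx Hv Hu Hu1. rewrite energy_chartB by exact Hu. cbv zeta.
  set (b := (1/2) * (x * u) + (1/2) * u ^ 2 - u ^ 3 * v).
  set (k := / RtoC (1 + Cmod u ^ 4)).
  pose proof (Cmod_ge_0 u) as H0. pose proof (Cmod_ge_0 x) as Hx0. pose proof (Cmod_ge_0 v) as Hv0.
  set (m := Cmod u) in *.
  assert (Hb : Cmod b <= (R + 1 + M) * m).
  { unfold b. eapply Rle_trans; [apply Cmod_triangle_minus|].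
    eapply Rle_trans; [apply Rplus_le_compat_r, Cmod_triangle|].
    rewrite !Cmod_mult, !Cmod_pow. fold m.
    replace (1/2) with (RtoC (1/2)) by (rewrite RtoC_div by lra; reflexivity).
    rewrite Cmod_R, Rabs_pos_eq by lra.
    assert (Cmod x * m <= R * m) by (apply Rmult_le_compat_r; lra).
    assert (m ^ 2 <= m) by nra.
    assert (m ^ 3 <= m) by nra.
    assert (0 <= m ^ 3) by (apply pow_le; lra).
    assert (m ^ 3 * Cmod v <= m * M) by (apply Rmult_le_compat; lra).
    assert (0 <= R * m) by nra. nra. }
  assert (Hk : 0 <= Cmod k <= 1).
  { split; [apply Cmod_ge_0|]. unfold k. pose proof (pow_le m 4 H0).
    rewrite <- RtoC_inv, Cmod_R, Rabs_pos_eq by (try (left; apply Rinv_0_lt_compat); lra).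
    rewrite <- Rinv_1. apply Rinv_le_contravar; lra. }
  eapply Rle_trans; [apply Cmod_triangle|].
  eapply Rle_trans; [apply Rplus_le_compat_r, Cmod_triangle_minus|].
  rewrite !Cmod_mult, !Cmod_pow, Cmod_R, Cmod_conj, (Rabs_pos_eq 2) by lra. fold m.
  pose proof (Cmod_ge_0 b) as Hb0. set (B := (R + 1 + M)%R) in *.
  assert (HB : 0 <= B) by (unfold B; lra).
  assert (E1 : Cmod b ^ 2 <= B ^ 2 * m ^ 2).
  { replace (B ^ 2 * m ^ 2)%R with ((B * m) ^ 2)%R by ring. apply pow_incr; lra. }
  assert (E2 : Cmod b * (m ^ 2 * Cmod k) <= B * m ^ 2).
  { apply Rle_trans with ((B * m) * m ^ 2)%R.
    - apply Rmult_le_compat; try lra; [nra|]. apply Rmult_le_self; nra.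
    - assert (0 <= B * m ^ 2) by nra. nra. }
  assert (E3 : m * (m * m) * Cmod k <= m ^ 2).
  { apply Rle_trans with (m * (m * m))%R; [apply Rmult_le_self; nra|nra]. }
  lra.
Qed.

(* w is -4 v(p), and v' = 0 at p. *)
Lemma energy_at_pole (f : C -> C) (p : C) : polar_at f p ->
  exists w : C, forall eps, 0 < eps -> exists del, 0 < del /\
    forall z, disc p del z -> z <> p ->
      Cmod (energy z (f z) (C_derive f z) - w) <= eps * Cmod (z - p).
Proof.
  intros HB. destruct (polar_at_near f p HB) as [d [u [v [Hd [Hu [H1 [H2 H3]]]]]]].
  destruct (sysB_at_zero u v p (proj1 (H1 p (disc_center p d Hd))) Hu) as [_ Hv].
  exists (- (4) * v p). intros eps He.
  destruct (cder_ccont _ _ _ Hv 1%R Rlt_0_1) as [d1 [Hd1 Hc]].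
  destruct (Hv (eps / 8)%R ltac:(lra)) as [d2 [Hd2 Hv2]].
  set (Rp := (Cmod p + 1)%R). set (M := (Cmod (v p) + 1)%R).
  set (K := ((Rp + 1 + M) ^ 2 + (Rp + 1 + M) + 2)%R).
  assert (HK : 0 < K).
  { unfold K, Rp, M. pose proof (Cmod_ge_0 p). pose proof (Cmod_ge_0 (v p)).
    pose proof (pow2_ge_0 (Cmod p + 1 + 1 + (Cmod (v p) + 1))). lra. }
  (* As |u| <= 2 |z - p|, the quadratic error is at most 4 K |z - p|^2 <= eps/2 |z - p|; the
     variation of 4 v accounts for the other half. *)
  set (d3 := Rmin (1/2) (eps / (8 * K))).
  assert (Hd3 : 0 < d3) by (apply Rmin_pos; [lra|apply Rdiv_lt_0_compat; lra]).
  set (del := Rmin (Rmin d d1) (Rmin d2 d3)).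
  assert (Hdel : 0 < del) by (apply Rmin_pos; apply Rmin_pos; lra).
  assert (del <= d /\ del <= d1 /\ del <= d2 /\ del <= 1/2 /\ del <= eps / (8 * K)) as [M1 [M2 [M3 [M4 M5]]]].
  { unfold del. pose proof (Rmin_l (Rmin d d1) (Rmin d2 d3)). pose proof (Rmin_r (Rmin d d1) (Rmin d2 d3)).
    pose proof (Rmin_l d d1). pose proof (Rmin_r d d1). pose proof (Rmin_l d2 d3). pose proof (Rmin_r d2 d3).
    pose proof (Rmin_l (1/2) (eps / (8 * K))). pose proof (Rmin_r (1/2) (eps / (8 * K))). fold d3 in H8, H9.
    repeat split; lra. }
  exists del. split; [exact Hdel|]. intros z Hz Hzp. unfold disc in Hz.
  destruct (H3 z ltac:(unfold disc; lra) Hzp) as [Hn _].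
  destruct (H1 z ltac:(unfold disc; lra)) as [HS Ef].
  assert (ED : C_derive f z = chartB_dy z (u z) (v z)).
  { apply cder_C_derive. apply (cder_eq_near (fun w => / u w ^ 2)).
    - destruct (disc_open p d z ltac:(unfold disc; lra)) as [d' [Hd' H']]. exists d'. split; [exact Hd'|].
      intros s Hs. symmetry. now apply H1, H'.
    - now apply sysB_sysA. }
  rewrite Ef, ED.
  pose proof (H2 z ltac:(unfold disc; lra)) as Hu2.
  pose proof (Cmod_triangle (u z - (z - p)) (z - p)) as T.
  replace (u z - (z - p) + (z - p)) with (u z) in T by ring.
  pose proof (Cmod_ge_0 (z - p)) as Hh0. pose proof (Cmod_ge_0 (u z)) as Hm0.
  assert (HzR : Cmod z <= Rp).
  { pose proof (Cmod_triangle (z - p) p). replace (z - p + p) with z in H by ring. unfold Rp. lra. }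
  assert (HvM : Cmod (v z) <= M).
  { specialize (Hc z ltac:(unfold disc; lra)). pose proof (Cmod_triangle (v z - v p) (v p)).
    replace (v z - v p + v p) with (v z) in H by ring. unfold M. lra. }
  pose proof (energy_near_pole z (u z) (v z) Rp M HzR HvM Hn ltac:(lra)) as HE. fold K in HE.
  specialize (Hv2 z ltac:(unfold disc; lra)).
  replace (v z - v p - 0 * (z - p)) with (v z - v p) in Hv2 by ring.
  replace (energy z (/ u z ^ 2) (chartB_dy z (u z) (v z)) - - (4) * v p)
    with ((energy z (/ u z ^ 2) (chartB_dy z (u z) (v z)) + 4 * v z) - 4 * (v z - v p)) by ring.
  eapply Rle_trans; [apply Cmod_triangle_minus|].
  rewrite (Cmod_mult 4), Cmod_R, Rabs_pos_eq by lra.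
  set (h := Cmod (z - p)) in *. set (m := Cmod (u z)) in *.
  assert (m ^ 2 <= 4 * h * h) by nra.
  assert (K * m ^ 2 <= K * (4 * h * h)) by (apply Rmult_le_compat_l; lra).
  assert (K * h <= eps / 8).
  { apply Rle_trans with (K * (eps / (8 * K)))%R; [apply Rmult_le_compat_l; lra|right; field; lra]. }
  nra.
Qed.

(* The energy is extended to the poles on the segment by its limit, where its
   derivative is 0, so that Gronwall applies on the whole segment. *)
Lemma energy_bound (f : C -> C) (a z : C) (rho : R) :
  (forall t, 0 <= t <= 1 -> mero_sol_at f (a + t * (z - a)) /\ Cmod (a + t * (z - a)) <= rho) ->
  regular_at f a -> regular_at f z ->
  1 + Cmod (energy z (f z) (C_derive f z)) ^ 2 <=
  exp (4 * (Cmod (z - a) * (20 + 10 * rho))) * (1 + Cmod (energy a (f a) (C_derive f a)) ^ 2).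
Proof.
  intros H Ha Hz. set (e := z - a). set (y := fun t : R => a + t * e).
  set (W := fun t => energy (y t) (f (y t)) (C_derive f (y t))).
  (* The squared modulus is differentiable even where [W] vanishes; the summand 1 absorbs the
     inhomogeneous term through w (1 + w) <= 2 (1 + w^2). *)
  set (N := fun t => (1 + Cmod (W t) ^ 2)%R).
  set (E := fun t => if excluded_middle_informative (regular_at f (y t)) then N t else real (Lim N t)).
  set (c := (4 * (Cmod e * (20 + 10 * rho)))%R).
  assert (Hy0 : y 0%R = a) by (unfold y; ring). assert (Hy1 : y 1%R = z) by (unfold y, e; ring).
  assert (HEA : forall t, regular_at f (y t) -> E t = N t).
  { intros t Ht. unfold E. now destruct excluded_middle_informative. }
  assert (HR : 0 <= rho).
  { destruct (H 0%R ltac:(lra)) as [_ HR]. eapply Rle_trans; [apply Cmod_ge_0|exact HR]. }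
  assert (Hc : 0 <= c).
  { unfold c. pose proof (Cmod_ge_0 e). nra. }
  assert (HD : forall t, 0 <= t <= 1 -> exists d, is_derive E t d /\ d <= c * E t).
  { intros t Ht. destruct (H t Ht) as [HS HtR]. fold (y t) in HS, HtR.
    destruct (classic (regular_at f (y t))) as [HA|HA].
    - pose proof (rder_energy f (C_derive f) a e t (regular_at_sys _ _ HA)) as D. cbv zeta in D.
      fold (y t) in D.
      pose proof (energy_rate (y t) (f (y t)) (C_derive f (y t)) e rho HtR) as B. cbv zeta in B.
      set (W' := e * (- (2) * (f (y t) * (/ (1 + f (y t) * Cconj (f (y t))) * (2 * / (1 + f (y t) * Cconj (f (y t))) - 1)))
          + y t * (phi (f (y t)) * (2 * / (1 + f (y t) * Cconj (f (y t))) - 1))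
          - phi (f (y t)) ^ 2 * energy (y t) (f (y t)) (C_derive f (y t)) + C_derive f (y t) * phi (f (y t)) ^ 3)
          + C_derive f (y t) * Cconj (C_derive f (y t)) * Cconj e * (/ (1 + f (y t) * Cconj (f (y t)))) ^ 2) in *.
      change (rder W t W') in D. fold (W t) in B.
      exists (2 * (Re (W t) * Re W' + Im (W t) * Im W'))%R. split.
      + apply is_derive_ext_loc with N.
        * destruct (regular_at_open f (y t) HA) as [d [Hd Hop]].
          destruct (line_near a e t d Hd) as [eta [Heta Hn]].
          exists (mkposreal eta Heta). intros s Hs. symmetry. apply HEA, Hop, Hn, Hs.
        * pose proof (is_derive_plus (V := R_NormedModule) (fun _ => 1%R) _ t 0%R _
            (is_derive_const (V := R_NormedModule) _ t) (rder_Cmod2 W t W' D)) as D2.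
          change plus with Rplus in D2. rewrite Rplus_0_l in D2. exact D2.
      + rewrite HEA by exact HA. unfold N.
        pose proof (Re_conj_mul_le (W t) W'). pose proof (Cmod_ge_0 (W t)).
        set (w := Cmod (W t)) in *. set (C0 := (Cmod e * (20 + 10 * rho))%R) in *.
        assert (0 <= C0) by (unfold c in Hc; lra).
        assert (w * Cmod W' <= w * (C0 * (1 + w))).
        { apply Rmult_le_compat_l; [lra|]. unfold C0. lra. }
        assert (w * (1 + w) <= 2 * (1 + w ^ 2)) by nra.
        unfold c. nra.
    - destruct HS as [HS|HS]; [contradiction|].
      destruct (energy_at_pole f (y t) HS) as [w Hw].
      (* [W] with its value at the pole parameter [t] replaced by the limit. *)
      set (W1 := fun s => if Req_EM_T s t then w else W s).
      assert (HW1t : W1 t = w) by (unfold W1; destruct (Req_EM_T t t); congruence).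
      assert (HW1 : forall s, s <> t -> W1 s = W s) by (intros s Hs; unfold W1; destruct (Req_EM_T s t); congruence).
      (* The segment is not a point, since otherwise the pole would be the regular point [a]. *)
      assert (He0 : 0 < Cmod e).
      { apply Cmod_gt_0. intros E0. apply HA. unfold y. rewrite E0.
        replace (a + t * 0) with a by ring. exact Ha. }
      assert (Hyne : forall s, s <> t -> y s <> y t).
      { intros s Hs E0. assert (E1 : RtoC (s - t) * e = 0).
        { rewrite RtoC_minus. replace ((s - t) * e) with (y s - y t) by (unfold y; ring). rewrite E0. ring. }
        apply (f_equal Cmod) in E1. rewrite Cmod_mult, Cmod_0, Cmod_R in E1.
        apply Rmult_integral in E1. destruct E1 as [E1|E1]; [|lra].
        apply Hs. apply Rabs_eq_0 in E1. lra. }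
      assert (D : rder W1 t 0).
      { apply rder_eps. intros eps Heps.
        destruct (Hw (eps / Cmod e)%R) as [d [Hd Hb]]; [now apply Rdiv_lt_0_compat|].
        destruct (line_near a e t d Hd) as [eta [Heta Hn]].
        exists eta. split; [exact Heta|]. intros s Hs. rewrite HW1t.
        destruct (Req_dec s t) as [->|Hst].
        - rewrite HW1t. replace (w - w - 0 * (t - t)%R) with (RtoC 0) by ring. rewrite Cmod_0.
          pose proof (Rabs_pos (t - t)). nra.
        - rewrite HW1 by exact Hst. replace (W s - w - 0 * (s - t)%R) with (W s - w) by ring.
          eapply Rle_trans; [apply Hb; [now apply Hn|now apply Hyne]|].
          replace (y s - y t) with (RtoC (s - t) * e) by (unfold y; rewrite RtoC_minus; ring).
          rewrite Cmod_mult, Cmod_R. right. field. lra. }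
      set (N1 := fun s => (1 + Cmod (W1 s) ^ 2)%R).
      assert (D1 : is_derive N1 t 0%R).
      { pose proof (is_derive_plus (V := R_NormedModule) (fun _ => 1%R) _ t 0%R _
            (is_derive_const (V := R_NormedModule) _ t) (rder_Cmod2 W1 t 0 D)) as D2.
        change plus with Rplus in D2. 
        replace (0 + 2 * (Re (W1 t) * Re 0 + Im (W1 t) * Im 0))%R with 0%R in D2 by (simpl; ring).
        exact D2. }
      assert (HL : Lim N t = Finite (N1 t)).
      { apply is_lim_unique. apply (is_lim_ext_loc N1).
        - exists (mkposreal 1 Rlt_0_1). intros s _ Hs. unfold N1, N. now rewrite HW1.
        - apply is_lim_continuity. apply derivable_continuous_pt. eexists. apply is_derive_Reals, D1. }
      assert (HEt : E t = N1 t).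
      { unfold E. destruct excluded_middle_informative; [contradiction|]. now rewrite HL. }
      exists 0%R. split.
      + apply is_derive_ext_loc with N1; [|exact D1].
        destruct (polar_at_near f (y t) HS) as [d [u [v [Hd [_ [_ [_ H3]]]]]]].
        destruct (line_near a e t d Hd) as [eta [Heta Hn]].
        exists (mkposreal eta Heta). intros s Hs.
        destruct (Req_dec s t) as [->|Hst]; [now rewrite HEt|].
        rewrite HEA; [unfold N1, N; now rewrite HW1|].
        apply H3; [now apply Hn|now apply Hyne].
      + rewrite HEt. apply Rmult_le_pos; [exact Hc|]. unfold N1. pose proof (Cmod_ge_0 (W1 t)). nra. }
  assert (HG : E 1%R <= exp (c * 1) * E 0%R).
  { apply (gronwall E (Derive E) c); [| |lra].
    - intros t Ht. destruct (HD t Ht) as [d [D1 _]]. apply Derive_correct. now exists d.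
    - intros t Ht. destruct (HD t Ht) as [d [D1 D2]].
      replace (Derive E t) with d by (symmetry; now apply is_derive_unique). exact D2. }
  rewrite Rmult_1_r in HG. rewrite !HEA in HG by (rewrite ?Hy0, ?Hy1; assumption).
  unfold N, W in HG. rewrite Hy0, Hy1 in HG. exact HG.
Qed.

(** * Local solutions with a uniform radius *)

Lemma Csqrt_exists (w : C) : exists u : C, u * u = w.
Proof.
  destruct w as [a b]. pose proof (re_le_Cmod (a, b)) as Ha. simpl in Ha.
  pose proof (Cmod2_alt (a, b)) as H2. simpl Re in H2. simpl Im in H2.
  set (r := Cmod (a, b)) in *. apply Rabs_le_between in Ha.
  assert (H1 : 0 <= (r + a) / 2) by lra. assert (H3 : 0 <= (r - a) / 2) by lra.
  assert (Hp : (sqrt ((r + a) / 2) * sqrt ((r - a) / 2) = Rabs b / 2)%R).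
  { rewrite <- sqrt_mult by assumption.
    replace ((r + a) / 2 * ((r - a) / 2))%R with (Rsqr (b / 2)).
    - rewrite sqrt_Rsqr_abs. unfold Rdiv. rewrite Rabs_mult, (Rabs_pos_eq (/ 2)) by lra. reflexivity.
    - unfold Rsqr. nra. }
  pose proof (sqrt_sqrt _ H1). pose proof (sqrt_sqrt _ H3).
  destruct (Rle_dec 0 b) as [Hb|Hb].
  - exists (sqrt ((r + a) / 2), sqrt ((r - a) / 2)).
    rewrite Rabs_pos_eq in Hp by lra. unfold Cmult; simpl. f_equal; lra.
  - exists (sqrt ((r + a) / 2), - sqrt ((r - a) / 2))%R.
    rewrite Rabs_left in Hp by lra. unfold Cmult; simpl. f_equal; lra.
Qed.

Lemma phi_inv_sq (u : C) : u <> 0 -> phi (/ u ^ 2) = u ^ 2 * / RtoC (1 + Cmod u ^ 4).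
Proof.
  intros Hu.
  assert (Ek : RtoC (1 + Cmod u ^ 4) = 1 + (u * Cconj u) ^ 2).
  { rewrite RtoC_plus, <- Cmod2_conj, <- RtoC_pow. do 2 f_equal. ring. }
  assert (Hk : RtoC (1 + Cmod u ^ 4) <> 0).
  { intros E. apply RtoC_inj in E. pose proof (pow_le (Cmod u) 4 (Cmod_ge_0 u)). lra. }
  rewrite Ek in *. unfold phi.
  destruct (Cpow_2_3_neq_0 u Hu) as [Hu2 _].
  rewrite Cinv_conj, Cpow_conj by exact Hu2.
  pose proof (Cconj_neq_0 u Hu) as HU. clear Ek Hu2. generalize dependent (Cconj u). intros U Hk HU.
  field. repeat split; auto.
Qed.

(** The bound on |v| produced by the next lemma: A = 2 rho + M + 2 bounds |y' u^3 + 2| / |u|^4, and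
    A^2, M, A and 2 bound the four terms of 4 v u^6 divided by |u|^6. *)
Definition vbound (rho M : R) : R := (((2 * rho + M + 2) ^ 2 + M + (2 * rho + M + 2) + 2) / 4)%R.

(* V = (y')^2 + ... is quadratic in q = y' u^3, with roots near 2 and -2; the sign of the
   square root u of 1/y is chosen so that q is near -2. *)
Lemma chartB_exists (x y q : C) (rho M : R) :
  Cmod x <= rho -> Cmod (energy x y q) <= M -> 1 <= Cmod y ->
  exists u v : C, u <> 0 /\ Cmod u <= 1 /\ y = / u ^ 2 /\ q = chartB_dy x u v /\ Cmod v <= vbound rho M.
Proof.
  intros Hx HM Hy.
  assert (Hy0 : y <> 0) by (apply Cmod_gt_0; lra).
  destruct (Csqrt_exists (/ y)) as [u0 Hu0].
  assert (Hu : exists u : C, u * u = / y /\ Re (q * u ^ 3) <= 0).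
  { destruct (Rle_dec (Re (q * u0 ^ 3)) 0) as [H|H]; [now exists u0|].
    exists (- u0). split; [rewrite <- Hu0; ring|].
    replace (q * (- u0) ^ 3) with (- (q * u0 ^ 3)) by ring.
    change (- Re (q * u0 ^ 3) <= 0)%R. lra. }
  clear u0 Hu0. destruct Hu as [u [Hu Hre]].
  assert (Hn : u <> 0).
  { intros ->. assert (E : y * / y = 0) by (rewrite <- Hu; ring). rewrite Cinv_r in E by exact Hy0.
    apply RtoC_inj in E. lra. }
  assert (Ey : y = / u ^ 2).
  { replace (u ^ 2) with (/ y) by (rewrite <- Hu; ring). field. exact Hy0. }
  assert (Hm : Cmod u <= 1).
  { assert (E : (Cmod u * Cmod u)%R = (/ Cmod y)%R) by (rewrite <- Cmod_mult, Hu, Cmod_inv; auto).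
    assert (/ Cmod y <= 1) by (rewrite <- Rinv_1; apply Rinv_le_contravar; lra).
    pose proof (Cmod_ge_0 u). nra. }
  set (qh := q * u ^ 3) in *.
  set (v := (qh + 2 + (1/2) * (x * u ^ 4) + (1/2) * u ^ 5) / u ^ 6).
  exists u, v. split; [exact Hn|]. split; [exact Hm|]. split; [exact Ey|]. split.
  { unfold chartB_dy, v, qh. field. exact Hn. }
  set (k := / RtoC (1 + Cmod u ^ 4)).
  set (d := qh + 2). set (V := energy x y q) in *. set (w := u ^ 5 * k).
  (* The definition of V times u^6, with the leading part qh^2 - 4 factored. *)
  assert (Eq : d * (qh - 2) = V * u ^ 6 + 2 * (x * u ^ 4) - qh * w).
  { unfold d, V, energy, w. rewrite Ey, phi_inv_sq by exact Hn. fold k. unfold qh. field. exact Hn. }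
  pose proof (Cmod_ge_0 u) as Hm0. set (m := Cmod u) in *.
  pose proof (pow_le m 4 Hm0) as Hm4.
  assert (Hk : 0 <= Cmod k <= 1).
  { split; [apply Cmod_ge_0|]. unfold k.
    rewrite <- RtoC_inv, Cmod_R, Rabs_pos_eq by (try (left; apply Rinv_0_lt_compat); lra).
    rewrite <- Rinv_1. apply Rinv_le_contravar; lra. }
  assert (H1k : Cmod (1 - k) <= m ^ 4).
  { unfold k. rewrite <- RtoC_inv by lra. rewrite <- RtoC_minus, Cmod_R.
    replace (1 - / (1 + m ^ 4))%R with (m ^ 4 * / (1 + m ^ 4))%R by (field; lra).
    assert (0 < / (1 + m ^ 4) <= 1).
    { split; [apply Rinv_0_lt_compat; lra|]. rewrite <- Rinv_1. apply Rinv_le_contravar; lra. }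
    rewrite Rabs_pos_eq by nra. apply Rmult_le_self; lra. }
  assert (Hpow : forall a b, (b <= a)%nat -> 0 <= m ^ a <= m ^ b).
  { intros a b Hab. split; [now apply pow_le|].
    replace a with (b + (a - b))%nat by lia. rewrite pow_add.
    apply Rmult_le_self; [now apply pow_le|]. rewrite <- (pow1 (a - b)). apply pow_incr. lra. }
  (* The choice of the sign of [u] enters here: it keeps [qh] away from 2, so that [Eq] bounds the
     other factor [d] by a multiple of |u|^4. *)
  assert (Hq2 : 2 <= Cmod (qh - 2)).
  { eapply Rle_trans; [|apply re_le_Cmod]. change (Re (qh - 2)) with (Re qh - 2)%R.
    rewrite Rabs_left1; lra. }
  pose proof (Cmod_ge_0 d) as Hd0. pose proof (Cmod_ge_0 x) as Hx0. pose proof (Cmod_ge_0 V) as HV0.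
  set (A := (2 * rho + M + 2)%R). assert (HA0 : 0 <= A) by (unfold A; lra).
  assert (Hw : Cmod w <= m ^ 5).
  { unfold w. rewrite Cmod_mult, Cmod_pow. fold m. apply Rmult_le_self; [apply pow_le|]; lra. }
  assert (Hqh : Cmod qh <= Cmod d + 2).
  { replace qh with (d - 2) by (unfold d; ring). eapply Rle_trans; [apply Cmod_triangle_minus|].
    rewrite Cmod_R, Rabs_pos_eq; lra. }
  assert (Hd : Cmod d <= A * m ^ 4).
  { assert (B : Cmod d * Cmod (qh - 2) <= M * m ^ 6 + 2 * (rho * m ^ 4) + (Cmod d + 2) * m ^ 5).
    { rewrite <- Cmod_mult, Eq. eapply Rle_trans; [apply Cmod_triangle_minus|].
      apply Rplus_le_compat; [eapply Rle_trans; [apply Cmod_triangle|]|].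
      - rewrite !Cmod_mult, !Cmod_pow, Cmod_R, Rabs_pos_eq by lra. fold m.
        apply Rplus_le_compat; [apply Rmult_le_compat_r; [now apply pow_le|lra]|].
        apply Rmult_le_compat_l; [lra|]. apply Rmult_le_compat_r; lra.
      - rewrite Cmod_mult. apply Rmult_le_compat; auto using Cmod_ge_0. }
    assert (Cmod d * 2 <= Cmod d * Cmod (qh - 2)) by (apply Rmult_le_compat_l; lra).
    destruct (Hpow 6%nat 4%nat ltac:(lia)). destruct (Hpow 5%nat 4%nat ltac:(lia)).
    assert (M * m ^ 6 <= M * m ^ 4) by (apply Rmult_le_compat_l; lra).
    assert (Cmod d * m ^ 5 <= Cmod d).
    { apply Rmult_le_self; [lra|]. destruct (Hpow 5%nat 0%nat ltac:(lia)). simpl in *; lra. }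
    unfold A. lra. }
  (* The bound d = O(u^4) alone would only give v = O(u^-2). Fed back into 4 d = d^2 - d (qh - 2),
     it shows that the terms in x u^4 and u^5 cancel up to 2 u^5 (1 - k), leaving O(u^6). *)
  assert (E4 : 4 * (qh + 2 + (1/2) * (x * u ^ 4) + (1/2) * u ^ 5)
     = d * d - V * u ^ 6 + d * w + 2 * (u ^ 5 * (1 - k))).
  { replace (V * u ^ 6) with (d * (qh - 2) - 2 * (x * u ^ 4) + qh * w) by (rewrite Eq; ring).
    unfold d, w. field. }
  assert (B4 : 4 * Cmod (qh + 2 + (1/2) * (x * u ^ 4) + (1/2) * u ^ 5) <= (A ^ 2 + M + A + 2) * m ^ 6).
  { replace 4%R with (Cmod 4) at 1 by (rewrite Cmod_R, Rabs_pos_eq; lra).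
    rewrite <- Cmod_mult, E4.
    eapply Rle_trans; [apply Cmod_triangle|]. eapply Rle_trans; [apply Rplus_le_compat_r, Cmod_triangle|].
    eapply Rle_trans; [apply Rplus_le_compat_r, Rplus_le_compat_r, Cmod_triangle_minus|].
    rewrite !Cmod_mult, !Cmod_pow, Cmod_R, Rabs_pos_eq by lra. fold m.
    destruct (Hpow 8%nat 6%nat ltac:(lia)) as [P1 P2]. destruct (Hpow 9%nat 6%nat ltac:(lia)) as [P3 P4].
    assert (T1 : Cmod d * Cmod d <= A ^ 2 * m ^ 6).
    { apply Rle_trans with ((A * m ^ 4) * (A * m ^ 4))%R.
      - apply Rmult_le_compat; lra.
      - replace ((A * m ^ 4) * (A * m ^ 4))%R with (A ^ 2 * m ^ 8)%R by ring.
        apply Rmult_le_compat_l; [apply pow_le; lra|lra]. }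
    assert (T2 : Cmod V * m ^ 6 <= M * m ^ 6) by (apply Rmult_le_compat_r; lra).
    assert (T3 : Cmod d * Cmod w <= A * m ^ 6).
    { apply Rle_trans with ((A * m ^ 4) * m ^ 5)%R.
      - apply Rmult_le_compat; auto using Cmod_ge_0.
      - replace ((A * m ^ 4) * m ^ 5)%R with (A * m ^ 9)%R by ring.
        apply Rmult_le_compat_l; lra. }
    assert (T4 : m ^ 5 * Cmod (1 - k) <= m ^ 6).
    { apply Rle_trans with (m ^ 5 * m ^ 4)%R.
      - apply Rmult_le_compat_l; [now apply pow_le|exact H1k].
      - replace (m ^ 5 * m ^ 4)%R with (m ^ 9)%R by ring. lra. }
    lra. }
  unfold v. rewrite Cmod_div by (now apply Cpow_nz). rewrite Cmod_pow. fold m.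
  assert (Hmp : 0 < m ^ 6) by (apply pow_lt; unfold m; now apply Cmod_gt_0).
  apply Rmult_le_reg_r with (m ^ 6)%R; [exact Hmp|].
  unfold Rdiv. rewrite Rmult_assoc, Rinv_l by lra. unfold vbound. fold A. lra.
Qed.

Lemma local_solution (rho M : R) : exists r, 0 < r /\ forall x0 y0 q0,
  Cmod x0 <= rho -> Cmod (energy x0 y0 q0) <= M ->
  exists f, (forall z, disc x0 r z -> mero_sol_at f z) /\ regular_at f x0 /\ f x0 = y0 /\ C_derive f x0 = q0.
Proof.
  (* For |y0| <= 1 the energy bound gives |q0|^2 <= M + 4 + 2 rho + |q0|, hence |q0| <= M + 2 rho +
     6. *)
  destruct (ode_exists FA1 FA2 (Rabs rho + Rabs M + 2 * Rabs rho + 6)) as [r1 [Hr1 H1]].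
  destruct (ode_exists FB1 FB2 (Rabs rho + 1 + Rabs (vbound rho M))) as [r2 [Hr2 H2]].
  pose proof (Rabs_pos rho). pose proof (Rabs_pos M). pose proof (Rabs_pos (vbound rho M)).
  pose proof (Rle_abs rho). pose proof (Rle_abs M). pose proof (Rle_abs (vbound rho M)).
  exists (Rmin r1 r2). split; [now apply Rmin_pos|]. intros x0 y0 q0 Hx HM.
  pose proof (Rmin_l r1 r2) as L1. pose proof (Rmin_r r1 r2) as L2.
  pose proof (Cmod_ge_0 x0).
  destruct (Rle_dec (Cmod y0) 1) as [Hy|Hy].
  - destruct (H1 x0 y0 q0) as [u [v [Eu [Ev HS]]]]; [lra|lra| |].
    { pose proof (momentum_bound x0 y0 q0 rho Hx) as B. pose proof (Cmod_ge_0 y0) as Hy0.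
      pose proof (Cmod_ge_0 q0) as Hq0.
      set (y := Cmod y0) in *. set (q := Cmod q0) in *.
      assert (y ^ 3 <= 1) by (rewrite <- (pow1 3); apply pow_incr; lra).
      assert (rho * y <= rho) by (apply Rmult_le_self; lra).
      assert (y * / (1 + y ^ 2) <= 1).
      { assert (0 < / (1 + y ^ 2) <= 1).
        { split; [apply Rinv_0_lt_compat; nra|]. rewrite <- Rinv_1 at 2. apply Rinv_le_contravar; nra. }
        nra. }
      assert (q * (y * / (1 + y ^ 2)) <= q) by (apply Rmult_le_self; lra).
      nra. }
    assert (HA : forall z, disc x0 r1 z -> regular_at u z).
    { intros z Hz. destruct (disc_open x0 r1 z Hz) as [d [Hd Hsub]].
      apply (regular_at_intro u u v z d Hd). intros w Hw. split; [apply HS, Hsub, Hw|reflexivity]. }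
    exists u. split; [|split; [|split]].
    + intros z Hz. left. apply HA. unfold disc in *; lra.
    + apply HA. now apply disc_center.
    + exact Eu.
    + rewrite <- Ev. apply cder_C_derive. apply (HS x0 (disc_center x0 r1 Hr1)).
  - destruct (chartB_exists x0 y0 q0 rho M Hx HM ltac:(lra)) as [u0 [v0 [Hn [Hu0 [Ey [Eq Hv0]]]]]].
    destruct (H2 x0 u0 v0) as [u [v [Eu [Ev HS]]]]; [lra|lra|lra|].
    exists (fun z => / u z ^ 2). split; [|split; [|split]].
    + intros z Hz. apply (chartB_mero_sol_at _ u v x0 r2); [|unfold disc in *; lra].
      intros w Hw. split; [now apply HS|reflexivity].
    + apply (chartB_regular _ u v x0 r2 Hr2); [|congruence].
      intros w Hw. split; [now apply HS|reflexivity].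
    + now rewrite Eu.
    + rewrite Eq, <- Eu, <- Ev. apply cder_C_derive.
      apply sysB_sysA; [apply HS, disc_center, Hr2|congruence].
Qed.

Lemma eq_near_trans (f g h : C -> C) (p : C) : eq_near f g p -> eq_near g h p -> eq_near f h p.
Proof.
  intros [d [Hd H]] [d' [Hd' H']]. exists (Rmin d d'). split; [now apply Rmin_pos|].
  intros z Hz. unfold disc in *. pose proof (Rmin_l d d'). pose proof (Rmin_r d d').
  rewrite H by lra. apply H'. lra.
Qed.

Lemma eq_near_of_data (f g : C -> C) (p : C) : regular_at f p -> regular_at g p ->
  f p = g p -> C_derive f p = C_derive g p -> eq_near f g p.
Proof.
  intros [d1 [Hd1 H1]] [d2 [Hd2 H2]] E1 E2.
  pose proof (Rmin_l d1 d2). pose proof (Rmin_r d1 d2).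
  exists (Rmin d1 d2). split; [now apply Rmin_pos|]. intros z Hz.
  assert (Hp : disc p (Rmin d1 d2) p) by now apply disc_center, Rmin_pos.
  apply (ode_unique FA1 FA2 f (C_derive f) g (C_derive g) p z); auto; intros t Ht;
    assert (disc p (Rmin d1 d2) (p + t * (z - p))) by (now apply convex_disc);
    [apply H1|apply H2]; unfold disc in *; lra.
Qed.

Lemma eq_near_C_derive (f g : C -> C) (p : C) : regular_at f p -> eq_near f g p -> C_derive f p = C_derive g p.
Proof.
  intros HA He. destruct (regular_at_sys f p HA) as [H _]. simpl in H. symmetry.
  apply cder_C_derive. now apply (cder_eq_near f g).
Qed.

Lemma regular_at_dense (f : C -> C) (p : C) (d : R) : 0 < d -> mero_sol_at f p -> exists q, disc p d q /\ regular_at f q.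
Proof.
  intros Hd [H|H].
  - exists p. split; [now apply disc_center|exact H].
  - destruct (polar_at_near f p H) as [d' [u [v [Hd' [_ [_ [_ H3]]]]]]].
    destruct (point_near p (Rmin d d')) as [q [Hq Hqp]]; [now apply Rmin_pos|].
    pose proof (Rmin_l d d'). pose proof (Rmin_r d d').
    exists q. split; [unfold disc in *; lra|]. apply H3; [unfold disc in *; lra|exact Hqp].
Qed.

(** * Continuation *)

(** The value at a point is chosen among those of the members whose disc contains it; compatibility
    makes the choice immaterial. Points in no disc get an arbitrary value. *)
Lemma glue (Fam : (C -> C) -> C -> R -> Prop) :
  (forall g c r g' c' r' z, Fam g c r -> Fam g' c' r' -> disc c r z -> disc c' r' z -> g z = g' z) ->
  exists F : C -> C, forall g c r z, Fam g c r -> disc c r z -> F z = g z.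
Proof.
  intros H.
  exists (fun z => epsilon (inhabits (RtoC 0)) (fun w => exists g c r, Fam g c r /\ disc c r z /\ w = g z)).
  intros g c r z HF Hz.
  destruct (epsilon_spec (inhabits (RtoC 0)) (fun w => exists g c r, Fam g c r /\ disc c r z /\ w = g z))
    as [g' [c' [r' [HF' [Hz' ->]]]]].
  - now exists (g z), g, c, r.
  - now apply (H g' c' r' g c r).
Qed.

Lemma connected_disc_and (c1 c2 : C) (r1 r2 : R) : 
  C_open (fun z => disc c1 r1 z /\ disc c2 r2 z) /\ C_connected (fun z => disc c1 r1 z /\ disc c2 r2 z).
Proof.
  split.
  - intros z [H1 H2]. apply locally_disc.
    destruct (disc_open _ _ _ H1) as [d1 [Hd1 S1]]. destruct (disc_open _ _ _ H2) as [d2 [Hd2 S2]].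
    pose proof (Rmin_l d1 d2). pose proof (Rmin_r d1 d2).
    exists (Rmin d1 d2). split; [now apply Rmin_pos|]. intros w Hw.
    split; [apply S1|apply S2]; unfold disc in *; lra.
  - apply convex_connected, convex_and; apply convex_disc.
Qed.

Lemma eq_near_two_discs (f g : C -> C) (c1 c2 : C) (r1 r2 : R) (a z : C) :
  (forall p, disc c1 r1 p -> mero_sol_at f p) -> (forall p, disc c2 r2 p -> mero_sol_at g p) ->
  disc c1 r1 a -> disc c2 r2 a -> eq_near f g a -> disc c1 r1 z -> disc c2 r2 z -> eq_near f g z.
Proof.
  intros Hf Hg H1 H2 He H3 H4. destruct (connected_disc_and c1 c2 r1 r2) as [Ho Hc].
  destruct (proj1 (locally_disc _ _) (Ho z (conj H3 H4))) as [d [Hd Hsub]].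
  exists d. split; [exact Hd|]. intros w Hw.
  apply (mero_sol_at_unique _ f g a Ho Hc); auto; intros p []; auto.
Qed.

Definition extends_to (f0 : C -> C) (a : C) (rho : R) : Prop :=
  exists f, (forall z, disc a rho z -> mero_sol_at f z) /\ eq_near f f0 a.

(* Two local solutions centred at c1 and c2 agree: if their discs meet, both contain
   the midpoint of c1 and c2, which lies in the disc where f is defined. *)
Lemma extension_step (f0 : C -> C) (a : C) (B : R) : regular_at f0 a ->
  exists r, 0 < r /\ forall rho, 0 < rho <= B -> extends_to f0 a rho -> extends_to f0 a (rho + r).
Proof.
  intros HA0.
  set (K := (Cmod a + Rabs B)%R).
  (* By Gronwall's inequality [M] bounds the energy at every regular point of the disc. It involves
     [B] but not [rho], so the gain [r / 2] is the same for all steps. *)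
  set (M := (exp (4 * (Rabs B * (20 + 10 * K))) * (1 + Cmod (energy a (f0 a) (C_derive f0 a)) ^ 2))%R).
  destruct (local_solution K M) as [r [Hr Hloc]].
  exists (r / 2)%R. split; [lra|]. intros rho Hrho [f [Hf Hef]].
  assert (HB : 0 < B) by lra.
  pose proof (Cmod_ge_0 a) as Ha0.
  assert (HK : 0 <= K) by (unfold K; pose proof (Rabs_pos B); lra).
  assert (HAf : regular_at f a) by (apply (regular_at_eq_near f0); [now apply eq_near_sym|exact HA0]).
  assert (HdK : forall z, disc a rho z -> Cmod z <= K).
  { intros z Hz. unfold disc in Hz. pose proof (Cmod_triangle (z - a) a).
    replace (z - a + a) with z in H by ring. unfold K. rewrite Rabs_pos_eq; lra. }
  assert (Hca : disc a rho a) by (apply disc_center; lra).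
  assert (HE : forall c, disc a rho c -> regular_at f c -> Cmod (energy c (f c) (C_derive f c)) <= M).
  { intros c Hc HAc.
    assert (H : 1 + Cmod (energy c (f c) (C_derive f c)) ^ 2 <= M).
    { eapply Rle_trans; [apply (energy_bound f a c K)|]; auto.
      - intros t Ht. assert (disc a rho (a + t * (c - a))) by now apply convex_disc. split; auto.
      - rewrite (eq_near_at f f0 a Hef), (eq_near_C_derive f f0 a HAf Hef). unfold M.
        apply Rmult_le_compat_r.
        + pose proof (pow2_ge_0 (Cmod (energy a (f0 a) (C_derive f0 a)))). lra.
        + assert (Cmod (c - a) * (20 + 10 * K) <= Rabs B * (20 + 10 * K)).
          { apply Rmult_le_compat_r; [lra|]. unfold disc in Hc. rewrite Rabs_pos_eq; lra. }
          assert (L : 4 * (Cmod (c - a) * (20 + 10 * K)) <= 4 * (Rabs B * (20 + 10 * K))) by lra.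
          destruct L as [L|L]; [left; now apply exp_increasing|right; now rewrite L]. }
    pose proof (Cmod_ge_0 (energy c (f c) (C_derive f c))). nra. }
  (* All discs have the same radius [r]; this is why the midpoint of the centres of two overlapping
     ones lies in both. *)
  set (Fam := fun (g : C -> C) (c : C) (r' : R) =>
    r' = r /\ disc a rho c /\ (forall z, disc c r z -> mero_sol_at g z) /\ eq_near g f c).
  assert (HFam : forall c, disc a rho c -> regular_at f c -> exists g, Fam g c r).
  { intros c Hc HAc. destruct (Hloc c (f c) (C_derive f c)) as [g [Hg [HAg [E1 E2]]]]; auto.
    exists g. repeat split; auto. now apply eq_near_of_data. }
  destruct (glue Fam) as [F HF].
  { intros g1 c1 r1 g2 c2 r2 z [-> [Hc1 [Hg1 He1]]] [-> [Hc2 [Hg2 He2]]] Hz1 Hz2.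
    set (m := c1 + (1/2)%R * (c2 - c1)).
    assert (Hm : disc a rho m) by (apply convex_disc; auto; lra).
    assert (H12 : Cmod (c2 - c1) < 2 * r).
    { replace (c2 - c1) with ((z - c1) - (z - c2)) by ring.
      eapply Rle_lt_trans; [apply Cmod_triangle_minus|]. unfold disc in *; lra. }
    assert (Hm1 : disc c1 r m).
    { unfold disc, m. replace (c1 + (1/2)%R * (c2 - c1) - c1) with (RtoC (1/2) * (c2 - c1)) by ring.
      rewrite Cmod_mult, Cmod_R, Rabs_pos_eq; lra. }
    assert (Hm2 : disc c2 r m).
    { unfold disc, m. replace (c1 + (1/2)%R * (c2 - c1) - c2) with (RtoC (-(1/2)) * (c2 - c1))
        by (rewrite RtoC_opp, RtoC_div by lra; field).
      rewrite Cmod_mult, Cmod_R, Rabs_left; lra. }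
    assert (E1 : eq_near g1 f m).
    { apply (eq_near_two_discs g1 f c1 a r rho c1); auto. now apply disc_center. }
    assert (E2 : eq_near g2 f m).
    { apply (eq_near_two_discs g2 f c2 a r rho c2); auto. now apply disc_center. }
    apply eq_near_at. apply (eq_near_two_discs g1 g2 c1 c2 r r m); auto.
    apply eq_near_trans with f; [exact E1|now apply eq_near_sym]. }
  assert (HFeq : forall g c z, Fam g c r -> disc c r z -> eq_near g F z).
  { intros g c z HFg Hz. destruct (disc_open c r z Hz) as [d [Hd Hsub]].
    exists d. split; [exact Hd|]. intros w Hw. symmetry. apply (HF g c r); auto. }
  exists F. split.
  - intros z Hz.
    (* The gain is r/2, so some x in the old disc lies within 3/4 r of [z]. A regular centre within
       r/4 of x then has [z] in its disc of radius [r]. *)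
    assert (Hx : exists x, disc a rho x /\ Cmod (z - x) < 3 / 4 * r).
    { destruct (Rlt_dec (Cmod (z - a)) rho) as [Hl|Hl].
      - exists z. split; [exact Hl|]. replace (z - z) with (RtoC 0) by ring. rewrite Cmod_0. lra.
      - set (m := Cmod (z - a)) in *. unfold disc in Hz. fold m in Hz.
        set (del := Rmin (rho / 2) (r / 8)).
        assert (Hdel : 0 < del) by (apply Rmin_pos; lra).
        pose proof (Rmin_l (rho / 2) (r / 8)). pose proof (Rmin_r (rho / 2) (r / 8)). fold del in H, H0.
        set (s := ((rho - del) / m)%R).
        assert (Hsm : (s * m)%R = (rho - del)%R) by (unfold s; field; lra).
        assert (Hs : 0 <= s <= 1).
        { split; [apply Rmult_le_reg_r with m; lra|apply Rmult_le_reg_r with m; lra]. }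
        exists (a + s * (z - a)). split.
        + unfold disc. replace (a + s * (z - a) - a) with (s * (z - a)) by ring.
          rewrite Cmod_mult, Cmod_R, Rabs_pos_eq by lra. fold m. lra.
        + replace (z - (a + s * (z - a))) with (RtoC (1 - s) * (z - a)) by (rewrite RtoC_minus; ring).
          rewrite Cmod_mult, Cmod_R, Rabs_pos_eq by lra. fold m. lra. }
    destruct Hx as [x [Hx Hxz]].
    destruct (disc_open a rho x Hx) as [d [Hd Hsub]].
    destruct (regular_at_dense f x (Rmin d (r / 4))) as [c [Hc HAc]]; [apply Rmin_pos; lra|auto|].
    pose proof (Rmin_l d (r / 4)). pose proof (Rmin_r d (r / 4)).
    assert (Hc' : disc a rho c) by (apply Hsub; unfold disc in *; lra).
    destruct (HFam c Hc' HAc) as [g Hg].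
    assert (Hzc : disc c r z).
    { unfold disc in *. replace (z - c) with ((z - x) - (c - x)) by ring.
      eapply Rle_lt_trans; [apply Cmod_triangle_minus|]. lra. }
    apply (mero_sol_at_eq_near g); [now apply (HFeq g c)|]. destruct Hg as [_ [_ [Hg _]]]. now apply Hg.
  - destruct (HFam a Hca HAf) as [g Hg].
    apply eq_near_trans with g; [apply eq_near_sym, (HFeq g a a Hg), disc_center, Hr|].
    apply eq_near_trans with f; [|exact Hef]. now destruct Hg as [_ [_ [_ Hg]]].
Qed.

Lemma extends_to_mono (f0 : C -> C) (a : C) (rho rho' : R) :
  rho' <= rho -> extends_to f0 a rho -> extends_to f0 a rho'.
Proof.
  intros H [f [Hf He]]. exists f. split; [|exact He]. intros z Hz. apply Hf. unfold disc in *; lra.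
Qed.

Lemma extends_to_all (f0 : C -> C) (a : C) : regular_at f0 a -> forall rho, extends_to f0 a rho.
Proof.
  intros HA rho.
  destruct (regular_at_open f0 a HA) as [d [Hd Hop]].
  assert (H0 : extends_to f0 a d).
  { exists f0. split; [intros z Hz; left; auto|]. exists 1%R. split; [lra|auto]. }
  destruct (extension_step f0 a (Rabs rho + d) HA) as [r [Hr Hstep]].
  pose proof (Rabs_pos rho). pose proof (Rle_abs rho).
  (* The step is available up to the radius |rho| + d, so the growing radius is cut off there. *)
  assert (Hn : forall n, extends_to f0 a (Rmin (Rabs rho + d) (d + INR n * r))).
  { induction n as [|n IH].
    - apply extends_to_mono with d; [|exact H0]. simpl.
      pose proof (Rmin_r (Rabs rho + d) (d + 0 * r)). lra.
    - apply Hstep in IH.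
      + revert IH. apply extends_to_mono. rewrite S_INR.
        unfold Rmin. destruct (Rle_dec (Rabs rho + d) (d + INR n * r)), (Rle_dec (Rabs rho + d) (d + (INR n + 1) * r)); lra.
      + split; [|apply Rmin_l]. apply Rmin_pos; [lra|].
        pose proof (pos_INR n). nra. }
  destruct (INR_unbounded (Rabs rho / r)) as [n Hn'].
  apply extends_to_mono with (Rmin (Rabs rho + d) (d + INR n * r)); [|apply Hn].
  assert (Rabs rho < INR n * r).
  { apply Rmult_lt_reg_r with (/ r)%R; [now apply Rinv_0_lt_compat|].
    rewrite Rmult_assoc, Rinv_r by lra. rewrite Rmult_1_r. exact Hn'. }
  apply Rmin_glb; lra.
Qed.

(** Extensions to discs of different radii about [a] agree on the smaller disc by the identity
    theorem, so they can be glued. *)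
Lemma global_extension (f0 : C -> C) (a : C) : regular_at f0 a ->
  exists F, (forall z, mero_sol_at F z) /\ eq_near F f0 a.
Proof.
  intros HA.
  destruct (glue (fun g c r => c = a /\ 0 < r /\ (forall z, disc a r z -> mero_sol_at g z) /\ eq_near g f0 a)) as [F HF].
  { intros g c r g' c' r' z [-> [Hr [Hg He]]] [-> [Hr' [Hg' He']]] Hz Hz'.
    apply eq_near_at. apply (eq_near_two_discs g g' a a r r' a); auto using disc_center.
    apply eq_near_trans with f0; [exact He|now apply eq_near_sym]. }
  assert (H : forall z, exists g, mero_sol_at g z /\ eq_near g F z /\ (z = a -> eq_near g f0 a)).
  { intros z. pose proof (Cmod_ge_0 (z - a)).
    destruct (extends_to_all f0 a HA (Cmod (z - a) + 1)) as [g [Hg He]].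
    assert (Hz : disc a (Cmod (z - a) + 1) z) by (unfold disc; lra).
    exists g. split; [now apply Hg|]. split; [|auto].
    destruct (disc_open _ _ _ Hz) as [d [Hd Hsub]]. exists d. split; [exact Hd|].
    intros w Hw. symmetry. apply (HF g a (Cmod (z - a) + 1)%R); [|now apply Hsub].
    repeat split; auto. lra. }
  exists F. split.
  - intros z. destruct (H z) as [g [H1 [H2 _]]]. now apply (mero_sol_at_eq_near g).
  - destruct (H a) as [g [_ [H2 H3]]]. apply eq_near_trans with g; [now apply eq_near_sym|auto].
Qed.

(** * Poles *)

Lemma regular_at_holomorphic (f : C -> C) (p : C) : regular_at f p -> holomorphic_at f p.
Proof.
  intros H. apply locally_disc. destruct (regular_at_open f p H) as [d [Hd Hop]].
  exists d. split; [exact Hd|]. intros z Hz. destruct (regular_at_sys f z (Hop z Hz)) as [Hc _].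
  eexists. apply cder_is_derive, Hc.
Qed.

Lemma locally'_disc (p : C) (P : C -> Prop) :
  locally' (T := C_UniformSpace) p P <->
  exists d : R, 0 < d /\ forall z, disc p d z -> z <> p -> P z.
Proof. apply (locally_disc p (fun z => z <> p -> P z)). Qed.

(** The cofactor of (z - p)^-2 is h^-2, where h = u / (z - p) and h(p) = 1. Differentiability of h
    at [p] is proved by hand: u' - 1 is a multiple of u^3, so u - (z - p) = O((z - p)^4) and h - 1 =
    O((z - p)^3), whence h'(p) = 0. *)
Lemma polar_at_pole (f : C -> C) (p : C) : polar_at f p -> pole_of_order f 2 p.
Proof.
  intros HB. destruct (polar_at_near f p HB) as [d [u [v [Hd [Hu [H1 [H2 H3]]]]]]].
  split; [lia|].
  set (h := fun z => if excluded_middle_informative (z = p) then RtoC 1 else u z / (z - p)).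
  assert (Hhp : h p = 1) by (unfold h; destruct excluded_middle_informative; congruence).
  assert (Hh : forall z, z <> p -> h z = u z / (z - p)).
  { intros z Hz. unfold h. destruct excluded_middle_informative; congruence. }
  assert (Hnz : forall z, z <> p -> z - p <> 0).
  { intros z Hz E. apply Hz. now apply Cminus_eq_0. }
  assert (Hh0 : forall z, disc p d z -> h z <> 0).
  { intros z Hz. destruct (classic (z = p)) as [->|Hzp].
    - rewrite Hhp. intros E. apply RtoC_inj in E. lra.
    - rewrite Hh by exact Hzp. unfold Cdiv. apply Cmult_neq_0; [now apply H3|].
      intros E. assert (E' : (z - p) * / (z - p) = 1) by (apply Cinv_r; auto). rewrite E in E'.
      rewrite Cmult_0_r in E'. apply RtoC_inj in E'. lra. }
  assert (Dh : forall z, disc p d z -> exists l, cder h z l).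
  { intros z Hz. destruct (classic (z = p)) as [->|Hzp].
    - exists 0. destruct (sysB_at_zero u v p (proj1 (H1 p Hz)) Hu) as [Hu1 Hv1].
      set (b := fun w => peval FB0 w (u w) (v w)).
      destruct (cder_ccont _ _ _ Hv1 1%R Rlt_0_1) as [d1 [Hd1 Hc]].
      destruct (peval_bounded FB0 (Cmod p + Cmod (v p) + 3)) as [Bd [HBd Hb]].
      set (d2 := Rmin (Rmin d d1) (1/2)).
      assert (Hd2 : 0 < d2) by (apply Rmin_pos; [apply Rmin_pos|]; lra).
      assert (d2 <= d /\ d2 <= d1 /\ d2 <= 1/2) as [M1 [M2 M3]].
      { unfold d2. pose proof (Rmin_l (Rmin d d1) (1/2)). pose proof (Rmin_r (Rmin d d1) (1/2)).
        pose proof (Rmin_l d d1). pose proof (Rmin_r d d1). repeat split; lra. }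
      assert (Hu2 : forall w, disc p d2 w -> Cmod (u w) <= 2 * Cmod (w - p)).
      { intros w Hw. pose proof (H2 w ltac:(unfold disc in *; lra)) as T1.
        pose proof (Cmod_triangle (u w - (w - p)) (w - p)) as T.
        replace (u w - (w - p) + (w - p)) with (u w) in T by ring.
        pose proof (Cmod_ge_0 (w - p)). lra. }
      (* The mean value inequality for u(s) - s, whose derivative b u^3 is bounded by Bd (2 rho)^3
         on the disc of radius rho. *)
      assert (Hub : forall rho w, 0 < rho <= d2 -> disc p rho w -> Cmod (u w - (w - p)) <= (Bd * (2 * rho) ^ 3) * Cmod (w - p)).
      { intros rho w Hrho Hw.
        replace (u w - (w - p)) with ((u w - w) - (u p - p)) by (rewrite Hu; ring).
        apply (cder_mvt (disc p rho) (fun s => u s - s) (fun s => b s * u s ^ 3)).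
        - apply convex_disc.
        - apply disc_center; lra.
        - exact Hw.
        - intros s Hs. destruct (H1 s ltac:(unfold disc in *; lra)) as [[Hs1 _] _].
          eapply cder_val; [|apply cder_minus; [exact Hs1|apply cder_id]].
          unfold b, FB1. cbn [peval]. ring.
        - intros s Hs. assert (Hs' := Hs). unfold disc in Hs'.
          pose proof (Hu2 s ltac:(unfold disc; lra)) as U. pose proof (Cmod_ge_0 (u s)).
          pose proof (Cmod_ge_0 p). pose proof (Cmod_ge_0 (v p)).
          rewrite Cmod_mult, Cmod_pow. apply Rmult_le_compat.
          + apply Cmod_ge_0.
          + apply pow_le; lra.
          + apply Hb.
            * pose proof (Cmod_triangle (s - p) p) as T. replace (s - p + p) with s in T by ring. lra.
            * lra.
            * specialize (Hc s ltac:(unfold disc; lra)). pose proof (Cmod_triangle (v s - v p) (v p)) as T.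
              replace (v s - v p + v p) with (v s) in T by ring. lra.
          + apply pow_incr. lra. }
      intros eps He.
      (* The factor 64 is 4^3: [Hub] is used with rho <= 2 |w - p|, so that 2 rho <= 4 |w - p|. *)
      set (d3 := Rmin d2 (eps / (64 * (Bd + 1)))).
      assert (Hd3 : 0 < d3) by (apply Rmin_pos; [lra|apply Rdiv_lt_0_compat; lra]).
      pose proof (Rmin_l d2 (eps / (64 * (Bd + 1)))) as M4. pose proof (Rmin_r d2 (eps / (64 * (Bd + 1)))) as M5.
      fold d3 in M4, M5.
      exists d3. split; [exact Hd3|]. intros w Hw.
      destruct (classic (w = p)) as [->|Hwp].
      { replace (h p - h p - 0 * (p - p)) with (RtoC 0) by ring. rewrite Cmod_0.
        apply Rmult_le_pos; [lra|apply Cmod_ge_0]. }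
      rewrite Hhp, Hh by exact Hwp.
      replace (u w / (w - p) - 1 - 0 * (w - p)) with ((u w - (w - p)) / (w - p)) by (field; auto).
      rewrite Cmod_div by auto. pose proof (Cmod_minus_pos w p Hwp) as Hpos.
      set (k := Cmod (w - p)) in *.
      apply Rmult_le_reg_r with k; [exact Hpos|]. unfold Rdiv. rewrite Rmult_assoc, Rinv_l by lra.
      rewrite Rmult_1_r.
      assert (Hk : k < d3) by exact Hw.
      apply le_epsilon. intros eta Heta.
      (* The disc of [Hub] is open, so its radius must strictly exceed k = |w - p|. *)
      set (rho := Rmin d3 (2 * k)).
      assert (Hrho : k < rho <= d3 /\ rho <= 2 * k).
      { unfold rho. split; [split|]; [apply Rmin_glb_lt; lra|apply Rmin_l|apply Rmin_r]. }
      eapply Rle_trans; [apply (Hub rho); [lra|unfold disc; fold k; lra]|]. fold k.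
      assert (Bd * (2 * rho) ^ 3 <= eps * k); [|nra].
      apply Rle_trans with ((Bd + 1) * (64 * (k * k * k)))%R.
      { apply Rmult_le_compat; try lra; [apply pow_le; lra|].
        replace (64 * (k * k * k))%R with ((4 * k) ^ 3)%R by ring. apply pow_incr; lra. }
      assert (k * k <= k) by nra.
      assert ((64 * (Bd + 1)) * k <= eps).
      { apply Rle_trans with ((64 * (Bd + 1)) * (eps / (64 * (Bd + 1))))%R.
        - apply Rmult_le_compat_l; lra.
        - right; field; lra. }
      assert (k * k * k <= k * k) by nra.
      replace ((Bd + 1) * (64 * (k * k * k)))%R with ((64 * (Bd + 1) * k) * (k * k))%R by ring.
      apply Rmult_le_compat; nra.
    - destruct (H1 z Hz) as [[Hz1 _] _].
      eexists. apply (cder_eq_near (fun w => u w * / (w - p))).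
      + exists (Cmod (z - p)). split; [now apply Cmod_minus_pos|].
        intros w Hw. symmetry. apply Hh. intros ->. unfold disc in Hw.
        rewrite Cmod_minus_sym in Hw. lra.
      + apply cder_mult; [exact Hz1|].
        apply (cder_inv (fun w => w - p)); [now apply Hnz|].
        apply cder_minus; [apply cder_id|apply cder_const]. }
  exists (fun z => / h z ^ 2). split; [|split].
  - apply locally_disc. exists d. split; [exact Hd|]. intros z Hz.
    destruct (Dh z Hz) as [l Hl]. eexists. apply cder_is_derive.
    apply (cder_inv (fun w => h w ^ 2)); [apply Cpow_nz; auto|]. apply cder_pow, Hl.
  - rewrite Hhp. replace (/ 1 ^ 2) with (RtoC 1) by field. intros E. apply RtoC_inj in E. lra.
  - apply locally'_disc. exists d. split; [exact Hd|]. intros z Hz Hzp.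
    destruct (H1 z Hz) as [_ ->]. rewrite Hh by exact Hzp.
    destruct (H3 z Hz Hzp) as [Hn _]. field. auto.
Qed.

(** * Uniqueness of the pole order *)

Lemma holomorphic_ccont (f : C -> C) (p : C) : holomorphic_at f p -> ccont f p.
Proof.
  intros H. apply locally_disc in H. destruct H as [d [Hd H]].
  destruct (H p (disc_center p d Hd)) as [l Hl]. apply cder_is_derive in Hl.
  now apply cder_ccont with l.
Qed.

(** If n < m, then h = g (z - p)^(m - n) tends to 0 at [p], against h(p) <> 0. *)
Lemma order_unique (g h : C -> C) (n m : nat) (p : C) : ccont g p -> ccont h p -> h p <> 0 ->
  (exists d, 0 < d /\ forall z, disc p d z -> z <> p -> g z / (z - p) ^ n = h z / (z - p) ^ m) ->
  (m <= n)%nat.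
Proof.
  intros Hg Hh Hp [d [Hd H]]. apply Nat.nlt_ge. intros Hlt.
  pose proof (proj1 (Cmod_gt_0 _) Hp) as Hpos.
  destruct (Hg 1%R Rlt_0_1) as [d1 [Hd1 H1]].
  destruct (Hh (Cmod (h p) / 2)%R ltac:(lra)) as [d2 [Hd2 H2]].
  set (G := (Cmod (g p) + 1)%R). assert (HG : 0 < G) by (unfold G; pose proof (Cmod_ge_0 (g p)); lra).
  set (d3 := Rmin 1 (Cmod (h p) / (2 * G))).
  assert (Hd3 : 0 < d3) by (apply Rmin_pos; [lra|apply Rdiv_lt_0_compat; lra]).
  pose proof (Rmin_l 1 (Cmod (h p) / (2 * G))) as M1. pose proof (Rmin_r 1 (Cmod (h p) / (2 * G))) as M2.
  fold d3 in M1, M2.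
  set (d4 := Rmin (Rmin d d1) (Rmin d2 d3)).
  assert (d4 <= d /\ d4 <= d1 /\ d4 <= d2 /\ d4 <= d3) as [M3 [M4 [M5 M6]]].
  { unfold d4. pose proof (Rmin_l (Rmin d d1) (Rmin d2 d3)). pose proof (Rmin_r (Rmin d d1) (Rmin d2 d3)).
    pose proof (Rmin_l d d1). pose proof (Rmin_r d d1). pose proof (Rmin_l d2 d3). pose proof (Rmin_r d2 d3).
    repeat split; lra. }
  destruct (point_near p d4) as [z [Hz Hzp]]; [apply Rmin_pos; apply Rmin_pos; lra|].
  unfold disc in Hz.
  specialize (H z ltac:(unfold disc; lra) Hzp). specialize (H1 z ltac:(unfold disc; lra)).
  specialize (H2 z ltac:(unfold disc; lra)).
  assert (Hn : z - p <> 0) by (intros E; apply Hzp; now apply Cminus_eq_0).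
  assert (E : h z = g z * (z - p) ^ (m - n)).
  { replace (h z) with (h z / (z - p) ^ m * (z - p) ^ m) by (field; now apply Cpow_nz).
    rewrite <- H. replace m with (n + (m - n))%nat at 1 by lia. rewrite Cpow_add_r.
    field. now apply Cpow_nz. }
  assert (Hhz : Cmod (h p) / 2 < Cmod (h z)).
  { pose proof (Cmod_triangle_inv (h p) (h z)). rewrite Cmod_minus_sym in H0. lra. }
  assert (Hgz : Cmod (g z) <= G).
  { pose proof (Cmod_triangle (g z - g p) (g p)). replace (g z - g p + g p) with (g z) in H0 by ring.
    unfold G. lra. }
  rewrite E, Cmod_mult, Cmod_pow in Hhz.
  set (k := Cmod (z - p)) in *. assert (Hk : 0 <= k) by apply Cmod_ge_0.
  assert (Hkp : k ^ (m - n) <= k).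
  { destruct (m - n)%nat as [|j] eqn:Ej; [lia|]. simpl. apply Rmult_le_self; [exact Hk|].
    rewrite <- (pow1 j). apply pow_incr. lra. }
  assert (Cmod (g z) * k ^ (m - n) <= G * k).
  { apply Rmult_le_compat; auto using Cmod_ge_0, pow_le. }
  assert (G * k <= G * (Cmod (h p) / (2 * G))) by (apply Rmult_le_compat_l; lra).
  replace (G * (Cmod (h p) / (2 * G)))%R with (Cmod (h p) / 2)%R in H3 by (field; lra).
  lra.
Qed.

Lemma pole_order_2 (f : C -> C) (n : nat) (p : C) : mero_sol_at f p -> pole_of_order f n p -> n = 2%nat.
Proof.
  intros Hs [Hn [g [Hg [Hgp Hf]]]]. apply holomorphic_ccont in Hg.
  apply locally'_disc in Hf. destruct Hf as [d [Hd Hf]].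
  destruct Hs as [HA|HB].
  - exfalso. assert (n <= 0)%nat; [|lia].
    (* At a regular point [f] is its own cofactor with exponent 0, which would force n = 0. *)
    apply (order_unique f g 0 n p); auto.
    + now apply holomorphic_ccont, regular_at_holomorphic.
    + exists d. split; [exact Hd|]. intros z Hz Hzp. rewrite <- Hf by assumption. simpl. field.
  - destruct (polar_at_pole f p HB) as [_ [h [Hh [Hhp Hf2]]]]. apply holomorphic_ccont in Hh.
    apply locally'_disc in Hf2. destruct Hf2 as [d2 [Hd2 Hf2]].
    assert (H : exists d, 0 < d /\ forall z, disc p d z -> z <> p -> g z / (z - p) ^ n = h z / (z - p) ^ 2).
    { exists (Rmin d d2). split; [now apply Rmin_pos|]. intros z Hz Hzp.
      pose proof (Rmin_l d d2). pose proof (Rmin_r d d2).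
      rewrite <- Hf, <- Hf2 by (auto; unfold disc in *; lra). reflexivity. }
    apply Nat.le_antisymm.
    + apply (order_unique h g 2 n p); auto.
      destruct H as [e [He H]]. exists e. split; [exact He|]. intros. symmetry. auto.
    + now apply (order_unique g h n 2 p).
Qed.

Theorem proposition4 (a : C) (U : C -> Prop) (y : C -> C)
    (hU : is_domain U) (haU : U a) (hy : P1_solution_on U y) :
  exists Y : C -> C,
    meromorphic Y /\
    (forall x, U x -> Y x = y x) /\
    (forall (p : C) (n : nat), pole_of_order Y n p -> n = 2%nat).
Proof.
  destruct hU as [Ho [Hc _]].
  assert (HA : forall x, U x -> regular_at y x).
  { intros x Hx. destruct (proj1 (locally_disc _ _) (Ho x Hx)) as [d [Hd Hsub]].
    exists d. split; [exact Hd|]. intros z Hz. destruct (hy z (Hsub z Hz)) as [H1 H2]. split.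
    - simpl. apply cder_is_derive, C_derive_correct; [exact z|exact H1].
    - apply cder_val with (6 * y z ^ 2 + z); [simpl; ring|]. now apply cder_is_derive. }
  destruct (global_extension y a (HA a haU)) as [Y [HY He]].
  exists Y. split; [|split].
  - intros p. destruct (HY p) as [H|H].
    + left. now apply regular_at_holomorphic.
    + right. exists 2%nat. now apply polar_at_pole.
  (* So far [Y] agrees with [y] near [a] only; connectedness of [U] spreads the agreement. *)
  - intros x Hx. apply (mero_sol_at_unique U Y y a Ho Hc); auto. intros p Hp. left. auto.
  - intros p n. apply pole_order_2, HY.
Qed.
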